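(* The language preservation problem for parametric event-recording automata remains undecidable when the untimed language is defined by a Büchi condition. That is, there is no algorithm that, given as input a parametric event-recording automaton $\mathsf{A}$ with parameter set $P$ and set $F$ of accepting locations, and a parameter valuation $v : P \to \mathbb{Q}_{+}$, decides whether there exists a parameter valuation $v' : P \to \mathbb{Q}_{+}$ with $v' \neq v$ such that $\mathsf{UL}_{B}(v'(\mathsf{A})) = \mathsf{UL}_{B}(v(\mathsf{A}))$, where $\mathsf{UL}_{B}(v(\mathsf{A}))$ is the set of all untimed words associated with a run of $v(\mathsf{A})$ that passes infinitely often through an accepting location (a location in $F$).
   Context: $\mathbb{Q}_{+}$ and $\mathbb{R}_{+}$ denote the non-negative rationals and non-negative reals. Clocks are real-valued variables that evolve at the same rate. For a set $X$ of clocks, a clock valuation is a function $\mu : X \to \mathbb{R}_{+}$; $\vec{0}$ is the valuation assigning $0$ to all clocks; for $d \in \mathbb{R}_{+}$, $(\mu+d)(x) = \mu(x)+d$ for all $x \in X$; for $x \in X$, $[\mu]_x$ is the valuation with $[\mu]_x(x) = 0$ and $[\mu]_x(x') = \mu(x')$ for $x' \neq x$. Parameters are unknown rational constants; for a set $P$ of parameters, a parameter valuation is a function $v : P \to \mathbb{Q}_{+}$. A guard $g$ over $X \cup P$ is a conjunction of inequalities $x \bowtie \eta$ with $x \in X$, $\eta$ either a parameter in $P$ or a constant in $\mathbb{Z}$, and ${\bowtie} \in \{<,\leq,\geq,>\}$. $v(g)$ is $g$ with each parameter $p$ replaced by $v(p)$. A parametric event-recording automaton (PERA) is a tuple $\mathsf{A}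 = (\Sigma, L, l_0, P, I, E)$ where $\Sigma$ is a finite set of actions, $L$ is a finite set of locations, $l_0 \in L$ is the initial location, $P$ is a finite set of parameters, $I$ assigns to every $l \in L$ a guard $I(l)$ (the invariant), and $E$ is a finite set of edges $e = (l, g, a, l')$ with $l,l' \in L$, $a \in \Sigma$ and $g$ a guard. Here it additionally comes with a set $F \subseteq L$ of accepting locations. The clocks are $X_\Sigma = \{x_a : a \in \Sigma\}$, one clock $x_a$ per action $a$; guards are over $X_\Sigma \cup P$, and $x_a$ is implicitly reset exactly on transitions labeled with $a$. For a parameter valuation $v$, $v(\mathsf{A})$ denotes the (non-parametric) automaton obtained by replacing each parameter $p$ by $v(p)$. Semantics of $v(\mathsf{A})$: the states are $S = \{(l,\mu) \in L \times \mathbb{R}_{+}^{|X_\Sigma|} : \mu \models v(I(l))\}$, and the initial state is $s_0 = (l_0, \vec{0})$. Discrete transitions: $(l,\mu) \xrightarrow{e} (l',\mu')$ if $(l,\mu),(l',\mu') \in S$ and there is $e = (l,g,a,l') \in E$ with $\mu' = [\mu]_{x_a}$ and $\mu \models v(g)$. Delay transitions: $(l,\mu) \xrightarrow{d} (l,\mu+d)$ for $d \in \mathbb{R}_{+}$ if $(l,\mu+d') \in S$ for all $d' \in [0,d]$. A run is a finite or infinite sequence $s_0 \xrightarrow{(d_0,e_0)} s_1 \xrightarrow{(d_1,e_1)} \cdots$ starting in the initial state, where each step is a delay $d_i$ followed by a discrete transition along $e_i$. Its untimed word is $a_0 a_1 \cdots$, where $a_i$ is the action of $e_i$. *)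

(* Defs.v *)
From HB Require Import structures.
From mathcomp Require Import all_boot all_order all_algebra.
From mathcomp Require Import classical_sets reals.

Set Implicit Arguments.
Unset Strict Implicit.
Unset Printing Implicit Defensive.

Import Order.TTheory GRing.Theory Num.Theory.

Local Open Scope ring_scope.

Variant cmp := Lt | Le | Ge | Gt.

Definition enc_cmp (c : cmp) : nat :=
  match c with Lt => 0%N | Le => 1%N | Ge => 2%N | Gt => 3%N end.

Lemma enc_cmp_inj : injective enc_cmp.
Proof. by case; case. Qed.

HB.instance Definition _ := Equality.copy cmp (inj_type enc_cmp_inj).

Definition cmp_holds (R : realType) (c : cmp) (x y : R) : bool :=
  match c with
  | Lt => x < y
  | Le => x <= y
  | Ge => x >= y
  | Gt => x > y
  end.

(* (a, c, t) is the inequality  x_a c t: since event-recording automata have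
   exactly one clock per action, clocks are named by actions. *)
Definition atom (Sigma T : Type) : Type := (Sigma * cmp * T)%type.

(* The conjunction of the listed inequalities. *)
Definition guard (Sigma T : Type) : Type := seq (atom Sigma T).

Record edge (Sigma L : finType) (T : eqType) := Edge {
  src : L;
  edge_guard : guard Sigma T;
  label : Sigma;
  tgt : L
}.

Definition edge_tuple (Sigma L : finType) (T : eqType) (e : edge Sigma L T) :
    L * seq (Sigma * cmp * T) * Sigma * L :=
  (src e, edge_guard e, label e, tgt e).

Lemma edge_tuple_inj Sigma L T : injective (@edge_tuple Sigma L T).
Proof. by move=> [s g a t] [s' g' a' t'] [-> -> -> ->]. Qed.

HB.instance Definition _ (Sigma L : finType) (T : eqType) :=
  Equality.copy (edge Sigma L T) (inj_type (@edge_tuple_inj Sigma L T)).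

(* T is the type of the right-hand sides of the inequalities in guards.  The
   list [edges] represents the finite set of its elements. *)
Record automaton (Sigma L : finType) (T : eqType) := Automaton {
  init : L;
  invariant : {ffun L -> guard Sigma T};
  edges : seq (edge Sigma L T);
  accepting : {set L}
}.

Definition pera (Sigma L P : finType) : Type := automaton Sigma L (P + int)%type.

Definition param_valuation (P : finType) : Type := {ffun P -> {q : rat | 0 <= q}}.

Definition inst_term (P : finType) (v : param_valuation P) (t : P + int) : rat :=
  match t with
  | inl p => val (v p)
  | inr z => z%:~R
  end.

Definition inst_guard (Sigma P : finType) (v : param_valuation P)
    (g : guard Sigma (P + int)%type) : guard Sigma rat :=
  [seq (c.1, inst_term v c.2) | c <- g].

Definition inst_edge (Sigma L P : finType) (v : param_valuation P)
    (e : edge Sigma L (P + int)%type) : edge Sigma L rat :=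
  Edge (src e) (inst_guard v (edge_guard e)) (label e) (tgt e).

Definition inst (Sigma L P : finType) (v : param_valuation P)
    (A : pera Sigma L P) : automaton Sigma L rat :=
  Automaton (init A) [ffun l => inst_guard v (invariant A l)]
    (map (inst_edge v) (edges A)) (accepting A).

Definition clock_valuation (R : realType) (Sigma : finType) : Type :=
  {ffun Sigma -> R}.

Section Semantics.
Variables (R : realType) (Sigma L : finType).
Implicit Types (mu : clock_valuation R Sigma) (A : automaton Sigma L rat).

Definition shift mu (d : R) : clock_valuation R Sigma := [ffun a => mu a + d].

Definition reset mu (a : Sigma) : clock_valuation R Sigma :=
  [ffun b => if b == a then 0 else mu b].

Definition satisfies mu (g : guard Sigma rat) : bool :=
  all (fun c => cmp_holds c.1.2 (mu c.1.1) (ratr c.2)) g.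

(* Membership in the state space S; nonnegativity of clock values is required
   here rather than in the type. *)
Definition is_state A (s : L * clock_valuation R Sigma) : Prop :=
  (forall a, 0 <= s.2 a) /\ satisfies s.2 (invariant A s.1).

Definition init_state A : L * clock_valuation R Sigma :=
  (init A, [ffun=> 0]).

Definition discrete_step A (e : edge Sigma L rat)
    (s s' : L * clock_valuation R Sigma) : Prop :=
  [/\ is_state A s, is_state A s', e \in edges A,
      s.1 = src e /\ s'.1 = tgt e
    & satisfies s.2 (edge_guard e) /\ s'.2 = reset s.2 (label e)].

Definition delay_step A (d : R) (s s' : L * clock_valuation R Sigma) : Prop :=
  [/\ 0 <= d, s' = (s.1, shift s.2 d)
    & forall d', 0 <= d' <= d -> is_state A (s.1, shift s.2 d')].

(* Only infinite runs are needed: a finite run does not visit any location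
   infinitely often. *)
Definition infinite_run A (s : nat -> L * clock_valuation R Sigma)
    (d : nat -> R) (e : nat -> edge Sigma L rat) : Prop :=
  [/\ s 0%N = init_state A, is_state A (s 0%N)
    & forall i, exists2 t, delay_step A (d i) (s i) t
                         & discrete_step A (e i) t (s i.+1)].

Definition buchi_accepting A (s : nat -> L * clock_valuation R Sigma) : Prop :=
  forall n, exists2 m, (n <= m)%N & (s m).1 \in accepting A.

Definition untimed_buchi_language A : set (nat -> Sigma) :=
  fun w => exists s d e,
    [/\ infinite_run A s d e, buchi_accepting A s
      & forall i, w i = label (e i)].

End Semantics.

Arguments untimed_buchi_language R {Sigma L} A.

(* Algorithms are modelled by n-ary partial recursive functions. *)
Inductive recfun : nat -> Type :=
| RZero n : recfun n
| RSucc : recfun 1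
| RProj n (i : 'I_n) : recfun n
| RComp m n (g : recfun m) (h : 'I_m -> recfun n) : recfun n
| RPrec n (g : recfun n) (h : recfun n.+2) : recfun n.+1
| RMu n (g : recfun n.+1) : recfun n.

(* Graph of the function F given by  F 0 xs = G xs  and
   F (k + 1) xs = H k (F k xs) xs. *)
Fixpoint prec_graph n (G : n.-tuple nat -> nat -> Prop)
    (H : n.+2.-tuple nat -> nat -> Prop)
    (k : nat) (xs : n.-tuple nat) (y : nat) : Prop :=
  match k with
  | 0%N => G xs y
  | k'.+1 => exists2 z, prec_graph G H k' xs z & H [tuple of k' :: z :: xs] y
  end.

(* [computes f xs y]: f is defined at xs, with value y. *)
Fixpoint computes n (f : recfun n) : n.-tuple nat -> nat -> Prop :=
  match f in recfun n return n.-tuple nat -> nat -> Prop with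
  | RZero _ => fun _ y => y = 0%N
  | RSucc => fun xs y => y = (thead xs).+1
  | RProj _ i => fun xs y => y = tnth xs i
  | RComp m _ g h => fun xs y =>
      exists2 zs : m.-tuple nat,
        (forall i, computes (h i) xs (tnth zs i)) & computes g zs y
  | RPrec _ g h => fun xs y =>
      prec_graph (computes g) (computes h) (thead xs) [tuple of behead xs] y
  | RMu _ g => fun xs y =>
      computes g [tuple of y :: xs] 0%N /\
      forall k, (k < y)%N -> exists z, computes g [tuple of k :: xs] z.+1
  end.

Lemma prec_graph_functional n (G : n.-tuple nat -> nat -> Prop)
    (H : n.+2.-tuple nat -> nat -> Prop) :
    (forall xs y y', G xs y -> G xs y' -> y = y') ->
    (forall xs y y', H xs y -> H xs y' -> y = y') ->
  forall k xs y y', prec_graph G H k xs y -> prec_graph G H k xs y' -> y = y'.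
Proof.
move=> fG fH; elim=> [|k IHk] xs y y' /=; first exact: fG.
by move=> [z Hz Hy] [z' Hz' Hy']; move: Hy'; rewrite -(IHk _ _ _ Hz Hz'); exact: fH.
Qed.

Lemma computes_functional n (f : recfun n) xs y y' :
  computes f xs y -> computes f xs y' -> y = y'.
Proof.
elim: f xs y y' => {n} [n|| n i|m n g IHg h IHh|n g IHg h IHh|n g IHg] xs y y' /=.
- by move=> -> ->.
- by move=> -> ->.
- by move=> -> ->.
- move=> [zs Hzs Hy] [zs' Hzs' Hy'].
  suff Ezs : zs = zs' by move: Hy'; rewrite -Ezs; exact: IHg.
  by apply: eq_from_tnth => i; apply: IHh (Hzs i) (Hzs' i).
- exact: prec_graph_functional.
- move=> [Hy Ly] [Hy' Ly']; case: (ltngtP y y') => // Hlt.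
  + by have [z Hz] := Ly' _ Hlt; have := IHg _ _ _ Hy Hz.
  + by have [z Hz] := Ly _ Hlt; have := IHg _ _ _ Hy' Hz.
Qed.

(* Q is decided by an algorithm whose inputs x are presented as enc x; nothing
   is required of the algorithm on numbers that do not encode an input. *)
Definition decidable_by_algorithm (T : Type) (enc : T -> nat)
    (Q : T -> Prop) : Prop :=
  exists f : recfun 1, forall x : T,
    (Q x -> computes f [tuple enc x] 1%N) /\
    (~ Q x -> computes f [tuple enc x] 0%N).

(* As inputs of an algorithm, the finite sets of actions, locations and
   parameters are initial segments of the natural numbers. *)
Record instance := Instance {
  nb_actions : nat;
  nb_locations : nat;
  nb_params : nat;
  inst_pera : pera 'I_nb_actions 'I_nb_locations 'I_nb_params;
  inst_val : param_valuation 'I_nb_params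
}.

(* [CodeSeq.code] is the library's explicit bijection from seq nat to nat. *)
Notation code := CodeSeq.code.

Definition enc_term n (t : 'I_n + int) : nat :=
  match t with
  | inl p => code [:: 0%N; val p]
  | inr (Posz k) => code [:: 1%N; k]
  | inr (Negz k) => code [:: 2%N; k]
  end.

Definition enc_atom m n (c : atom 'I_m ('I_n + int)%type) : nat :=
  code [:: val c.1.1; enc_cmp c.1.2; enc_term c.2].

Definition enc_guard m n (g : guard 'I_m ('I_n + int)%type) : nat :=
  code (map (@enc_atom m n) g).

Definition enc_edge m l n (e : edge 'I_m 'I_l ('I_n + int)%type) : nat :=
  code [:: val (src e); enc_guard (edge_guard e); val (label e); val (tgt e)].

Definition enc_rat (q : {q : rat | 0 <= q}) : nat :=
  code [:: `|numq (val q)|%N; `|denq (val q)|%N].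

Definition enc_pera m l n (A : pera 'I_m 'I_l 'I_n) : nat :=
  code [:: val (init A);
           code [seq enc_guard (invariant A i) | i <- enum 'I_l];
           code [seq enc_edge e | e <- edges A];
           code [seq val i | i <- enum (accepting A)]].

Definition enc_valuation n (v : param_valuation 'I_n) : nat :=
  code [seq enc_rat (v p) | p <- enum 'I_n].

Definition enc_instance (i : instance) : nat :=
  code [:: nb_actions i; nb_locations i; nb_params i;
           enc_pera (inst_pera i); enc_valuation (inst_val i)].

Lemma code_inj : injective code.
Proof. exact: can_inj CodeSeq.codeK. Qed.

Lemma enc_term_inj n : injective (@enc_term n).
Proof.
by move=> [p|[k|k]] [p'|[k'|k']] /code_inj [] // => [/val_inj||] ->.
Qed.

Lemma enc_atom_inj m n : injective (@enc_atom m n).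
Proof.
move=> [[a c] t] [[a' c'] t'] /code_inj[].
by move=> /val_inj-> /enc_cmp_inj-> /enc_term_inj->.
Qed.

Lemma enc_guard_inj m n : injective (@enc_guard m n).
Proof. by move=> g g' /code_inj/(inj_map (@enc_atom_inj m n)). Qed.

Lemma enc_edge_inj m l n : injective (@enc_edge m l n).
Proof.
move=> [s g a t] [s' g' a' t'] /code_inj[].
by move=> /val_inj/= -> /enc_guard_inj-> /val_inj/= -> /val_inj/= ->.
Qed.

Lemma enc_rat_inj : injective enc_rat.
Proof.
move=> [x x0] [y y0] /code_inj[/= En Ed]; apply: val_inj => /=.
have nE (z : rat) : 0 <= z -> z = `|numq z|%N%:Q / `|denq z|%N%:Q.
  by move=> z0; rewrite !gez0_abs ?numq_ge0 ?denq_ge0 // divq_num_den.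
by rewrite (nE x x0) (nE y y0) En Ed.
Qed.

Lemma enc_pera_inj m l n : injective (@enc_pera m l n).
Proof.
move=> [i I E F] [i' I' E' F'] /code_inj[] /val_inj/= ->.
move=> /code_inj/eq_in_map EI /code_inj/(inj_map (@enc_edge_inj m l n))->.
move=> /code_inj/(inj_map val_inj) EF; congr Automaton.
  by apply/ffunP => k; apply/enc_guard_inj/EI; rewrite mem_enum.
by apply/setP => k; rewrite -(mem_enum (mem F)) EF mem_enum.
Qed.

Lemma enc_valuation_inj n : injective (@enc_valuation n).
Proof.
move=> v v' /code_inj/eq_in_map E; apply/ffunP => p.
by apply/enc_rat_inj/E; rewrite mem_enum.
Qed.

Lemma enc_instance_inj : injective enc_instance.
Proof.
move=> [m l n A v] [m' l' n' A' v'] /code_inj[/= Em El En].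
case: m' / Em A' => A'; case: l' / El A' => A'; case: n' / En A' v' => A' v'.
by move=> /enc_pera_inj-> /enc_valuation_inj->.
Qed.

(* Main.v *)
Require Import Defs.
From HB Require Import structures.
From mathcomp Require Import all_boot all_order all_algebra.
From mathcomp Require Import boolp classical_sets reals.
From mathcomp Require Import zify ring lra.

(* Diagonalising over a constant in a guard replaces a universal machine.  The actions
   a_0, ..., a_k are forced to occur in this cyclic order, so that the Buechi
   language is either empty or the singleton of one fixed word.  Register r of a
   counter machine is the delay between a_r and a_(r+1).  With two parameters p
   and q = p + 1, letting every a_j occur p time units after its previous
   occurrence keeps all registers; delaying a_(r+1), ..., a_k by one more unit
   increments register r, and delaying a_0, ..., a_r instead decrements it; this
   works as long as the sum of the registers is at most p.  Only the halting
   location is accepting, and it is also reachable directly when p = q = 0: hence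
   for v = 0 there is some v' <> v with the same language iff the machine halts.
   Given a decision procedure f, let c encode all the edges but two of the
   automaton simulating the machine that, on input n, halts iff
   f (instance_code n n) = 0, where instance_code c n encodes the instance in which
   c is completed by two edges, one of which loads the constant n.  On input c, the
   machine halts iff f rejects the very instance that asks whether it halts. *)

Set Implicit Arguments.
Unset Strict Implicit.
Unset Printing Implicit Defensive.

(** * Nondeterministic counter programs and their compilation from recursive functions *)

Section Star.
Variables (T : Type) (B : T -> T -> Prop).

Inductive star : T -> T -> Prop :=
| star_refl x : star x x
| star_step x y z : B x y -> star y z -> star x z.

Lemma star_trans x y z : star x y -> star y z -> star x z.
Proof. by elim=> // {}x y' {}y Bx _ IH /IH; apply: star_step. Qed.

Lemma star1 x y : B x y -> star x y.
Proof. by move=> Bxy; apply: star_step Bxy (star_refl y). Qed.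

End Star.

Definition store : Type := nat -> nat.

Implicit Types (sg tau rho : store) (r b : nat).

Definition upd sg r (x : nat) : store := fun i => if i == r then x else sg i.

Lemma updE sg r x i : upd sg r x i = if i == r then x else sg i.
Proof. by []. Qed.

Ltac store_eq :=
  let i := fresh "i" in apply: funext => i /=; rewrite ?updE;
  repeat (case: eqVneq => [?|?]; try subst; rewrite ?updE ?eqxx /=); try lia.

Variant op := Nop | Inc of nat | Dec of nat | Zero of nat.

Definition op_step (o : op) sg tau : Prop :=
  match o with
  | Nop => tau = sg
  | Inc r => tau = upd sg r (sg r).+1
  | Dec r => 0 < sg r /\ tau = upd sg r (sg r).-1
  | Zero r => sg r = 0 /\ tau = sg
  end.

Inductive prog := Do of op | Seq of prog & prog | Star of prog.

Fixpoint den (p : prog) : store -> store -> Prop :=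
  match p with
  | Do o => op_step o
  | Seq p1 p2 => fun sg tau => exists2 rho, den p1 sg rho & den p2 rho tau
  | Star p1 => star (den p1)
  end.

Definition drain r (body : prog) : prog := Seq (Star body) (Do (Zero r)).

Lemma den_drain (I : store -> Prop) (F : store -> store) r body :
    (forall sg, I sg -> 0 < sg r -> I (F sg) /\ F sg r = (sg r).-1) ->
    (forall sg tau, I sg -> den body sg tau <-> 0 < sg r /\ tau = F sg) ->
  forall sg tau, I sg -> den (drain r body) sg tau <-> tau = iter (sg r) F sg.
Proof.
move=> HF HB sg tau Isg; split=> [[rho Hs [r0 ->]]|->] {tau}.
  elim: Hs Isg r0 => {sg rho} [sg _ -> //|sg rho1 rho Hb _ IH Isg r0].
  have [sg0 E] := (HB _ _ Isg).1 Hb; subst rho1; have [IF EF] := HF _ Isg sg0.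
  by rewrite (IH IF r0) EF -iterSr prednK.
move E: (sg r) => m; elim: m sg E Isg => [|m IH] sg E Isg.
  by exists sg => //; apply: star_refl.
have sg0 : 0 < sg r by rewrite E.
have [IF EF] := HF _ Isg sg0; rewrite iterSr.
case: (IH (F sg)) => //; first by rewrite EF E.
by move=> rho Hs Hz; exists rho => //; apply: star_step Hs; apply/HB.
Qed.

Definition clear r := drain r (Do (Dec r)).

Lemma den_clear r sg tau : den (clear r) sg tau <-> tau = upd sg r 0.
Proof.
rewrite (@den_drain (fun=> True) (fun sg => upd sg r (sg r).-1)) //.
  suff -> : iter (sg r) (fun sg => upd sg r (sg r).-1) sg = upd sg r 0 by [].
  move E: (sg r) => m; elim: m sg E => [|m IH] sg E; first by store_eq.
  by rewrite iterSr IH ?updE ?eqxx ?E //; store_eq.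
by move=> sg' _ _; rewrite updE eqxx.
Qed.

Definition move_reg r s := drain r (Seq (Do (Dec r)) (Do (Inc s))).

Lemma den_move r s sg tau : r != s ->
  den (move_reg r s) sg tau <-> tau = upd (upd sg s (sg s + sg r)) r 0.
Proof.
move=> rs; pose F sg := upd (upd sg r (sg r).-1) s (sg s).+1.
rewrite (@den_drain (fun=> True) F) //.
- suff -> : iter (sg r) F sg = upd (upd sg s (sg s + sg r)) r 0 by [].
  move E: (sg r) => m; elim: m sg E => [|m IH] sg E; first by store_eq.
  have Er : F sg r = m by rewrite /F !updE (negbTE rs) eqxx E.
  by rewrite iterSr IH ?Er // /F; store_eq.
- by move=> sg' _ _; rewrite /F !updE (negbTE rs) eqxx.
move=> sg' tau' _ /=; split=> [[rho [? ->] ->]|[? ->]].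
  by split=> //; rewrite /F updE eq_sym (negbTE rs).
by eexists; [split; [|reflexivity]|rewrite /F updE eq_sym (negbTE rs)].
Qed.

Definition copy_reg r s t :=
  Seq (drain r (Seq (Do (Dec r)) (Seq (Do (Inc s)) (Do (Inc t))))) (move_reg t r).

Lemma den_copy r s t sg tau : r != s -> r != t -> s != t -> sg t = 0 ->
  den (copy_reg r s t) sg tau <-> tau = upd sg s (sg s + sg r).
Proof.
move=> rs rt st t0; have tr : t != r by rewrite eq_sym.
have neq := (negbTE rs, negbTE rt, negbTE st, eq_sym s r, negbTE tr, eq_sym t s).
pose F sg := upd (upd (upd sg r (sg r).-1) s (sg s).+1) t (sg t).+1.
have FrE sg' : F sg' r = (sg' r).-1 by rewrite /F !updE !neq eqxx.
have EF m sg' : m = sg' r ->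
    iter m F sg' = upd (upd (upd sg' s (sg' s + m)) t (sg' t + m)) r 0.
  elim: m sg' => [|m IH] sg' E; first by store_eq.
  by rewrite iterSr IH ?FrE -?E // /F; store_eq.
have HF sg' tau' : den (drain r (Seq (Do (Dec r)) (Seq (Do (Inc s)) (Do (Inc t)))))
    sg' tau' <-> tau' = iter (sg' r) F sg'.
  apply: (@den_drain (fun=> True) F) => // sg1 tau1 _ /=.
  split=> [[_ [? ->] [_ -> ->]]|[? ->]].
    by split=> //; rewrite /F !updE !neq.
  eexists; [split; [done|reflexivity]|eexists; [reflexivity|]].
  by rewrite /F !updE !neq.
have <- : upd (upd (iter (sg r) F sg) r (iter (sg r) F sg r + iter (sg r) F sg t)) t 0
   = upd sg s (sg s + sg r) by rewrite EF //; store_eq.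
split=> [[rho /HF -> /(den_move _ _ tr) //]|->].
by exists (iter (sg r) F sg); [apply/HF|apply/(den_move _ _ tr)].
Qed.

Definition seqs (ps : seq prog) : prog := foldr Seq (Do Nop) ps.

(* Registers from [b] on are scratch: zero before and after execution. *)
Fixpoint compile n (f : recfun n) : n.-tuple nat -> nat -> nat -> prog :=
  match f in recfun n return n.-tuple nat -> nat -> nat -> prog with
  | RZero _ => fun _ _ _ => Do Nop
  | RSucc => fun ins out b =>
      Seq (copy_reg (thead ins) out b) (Do (Inc out))
  | RProj _ i => fun ins out b => copy_reg (tnth ins i) out b
  | RComp m _ g h => fun ins out b =>
      Seq (seqs [seq compile (h i) ins (b + i) (b + m) | i <- enum 'I_m])
        (Seq (compile g [tuple b + i | i < m] out (b + m))
           (seqs [seq clear (b + i) | i : 'I_m <- enum 'I_m]))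
  | RPrec _ g h => fun ins out b =>
      Seq (compile g [tuple of behead ins] out b)
        (Seq (copy_reg (thead ins) b.+1 b.+2)
           (Seq (drain b.+1 (Seq (Do (Dec b.+1))
              (Seq (compile h [tuple of b :: out :: behead ins] b.+2 b.+3)
                 (Seq (clear out) (Seq (move_reg b.+2 out) (Do (Inc b)))))))
              (clear b)))
  | RMu _ g => fun ins out b =>
      let run := compile g [tuple of out :: ins] b b.+1 in
      Seq (Star (Seq run (Seq (Do (Dec b)) (Seq (clear b) (Do (Inc out))))))
        (Seq run (Do (Zero b)))
  end.

Definition ready n (ins : n.-tuple nat) out b sg : Prop :=
  [/\ all (fun r => r < b) ins, out < b, out \notin ins, sg out = 0
    & forall r, b <= r -> sg r = 0].

Lemma map_upd n (ins : n.-tuple nat) sg r x : r \notin ins ->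
  map_tuple (upd sg r x) ins = map_tuple sg ins.
Proof.
move=> rins; apply: val_inj => /=; apply/eq_in_map => i iins; rewrite updE.
by case: eqVneq => // E; move: rins; rewrite -E iins.
Qed.

Lemma upd0 sg r : sg r = 0 -> upd sg r 0 = sg.
Proof. by move=> r0; store_eq. Qed.

Lemma updK sg r x y : upd (upd sg r x) r y = upd sg r y.
Proof. by store_eq. Qed.

Lemma thead_map n (ins : n.+1.-tuple nat) sg :
  thead (map_tuple sg ins) = sg (thead ins).
Proof. by rewrite /thead tnth_map. Qed.

Lemma behead_map_tuple n (ins : n.+1.-tuple nat) sg :
  [tuple of behead (map_tuple sg ins)] = map_tuple sg [tuple of behead ins].
Proof. by apply: val_inj; rewrite /= behead_map. Qed.

Definition compile_spec n (f : recfun n) := forall ins out b sg tau,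
  ready ins out b sg -> den (compile f ins out b) sg tau <->
    exists2 y, computes f (map_tuple sg ins) y & tau = upd sg out y.

Lemma compile_mu n (g : recfun n.+1) : compile_spec g -> compile_spec (RMu g).
Proof.
move=> IH ins out b sg tau [lt_ins lt_out out_ins out0 sg0].
set xs := map_tuple sg ins.
have b_ins : b \notin ins.
  by apply/negP => /(allP lt_ins); rewrite ltnn.
have bout : out == b = false by lia.
have ups : upd sg out 0 = sg by rewrite upd0.
have run y tau' : den (compile g [tuple of out :: ins] b b.+1) (upd sg out y) tau' <->
    exists2 z, computes g [tuple of y :: xs] z & tau' = upd (upd sg out y) b z.
  rewrite IH.
    suff -> : map_tuple (upd sg out y) [tuple of out :: ins] = [tuple of y :: xs] by [].
    by rewrite /xs -(map_upd sg y out_ins); apply: val_inj; rewrite /= updE eqxx.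
  split; rewrite ?updE //=.
  - by rewrite ltnS ltnW //=; apply/allP => r /(allP lt_ins)/= ?; lia.
  - by rewrite inE eq_sym bout.
  - by rewrite eq_sym bout; apply: sg0.
  - by move=> r ltr; rewrite updE; case: eqVneq => [E|_]; [lia|apply: sg0; lia].
pose body := Seq (compile g [tuple of out :: ins] b b.+1)
  (Seq (Do (Dec b)) (Seq (clear b) (Do (Inc out)))).
have bodyE y tau' : den body (upd sg out y) tau' <->
    exists2 z, computes g [tuple of y :: xs] z.+1 & tau' = upd sg out y.+1.
  split.
    move=> /= [_ /run[z Hz ->]] [_ [z0 ->] [_ /den_clear -> ->]].
    move: z0 Hz; rewrite updE eqxx => z0 Hz; exists z.-1; first by rewrite prednK.
    by have b0 := sg0 b (leqnn _); store_eq.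
  move=> [z Hz ->]; exists (upd (upd sg out y) b z.+1); first by apply/run; exists z.+1.
  exists (upd (upd sg out y) b z); first by split; rewrite ?updE ?eqxx //; store_eq.
  exists (upd sg out y).
    by apply/den_clear; have b0 := sg0 b (leqnn _); store_eq.
  by rewrite /= updE eqxx updK.
have loop y rho : star (den body) (upd sg out y) rho ->
    exists y', [/\ y <= y', rho = upd sg out y' & forall k, y <= k < y' ->
      exists z, computes g [tuple of k :: xs] z.+1].
  move E: (upd sg out y) => s0 Hs; elim: Hs y E => {s0 rho} [s0|s0 s1 s2 Hb _ IHs] y E.
    by exists y; split=> // k; lia.
  subst s0; have [z Hz E] := (bodyE _ _).1 Hb; have [y' [yy' -> Hy']] := IHs _ (esym E).
  exists y'; split=> //; first lia.
  move=> k Hk; have [->|kNy] := eqVneq k y; first by exists z.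
  by apply: Hy'; lia.
split=> /=.
  move=> [rho Hs [rho' Hr [z0 ->]]]; rewrite -ups in Hs.
  have [y [_ Ey Hy]] := loop _ _ Hs; subst rho.
  have [z Hz E] := (run _ _).1 Hr; subst rho'; move: z0; rewrite updE eqxx => z0.
  subst z; exists y; last by have b0 := sg0 b (leqnn _); store_eq.
  by split=> // k ky; apply: Hy.
move=> [y [Hy ltHy] ->].
have Hs : forall k, k <= y -> star (den body) sg (upd sg out k).
  elim=> [|k IHk] ky; first by rewrite ups; apply: star_refl.
  apply: star_trans (IHk (ltnW ky)) (star1 _); apply/bodyE.
  by have [z Hz] := ltHy _ ky; exists z.
exists (upd sg out y); first exact: Hs.
exists (upd sg out y).
  by apply/run; exists 0 => //; have b0 := sg0 b (leqnn _); store_eq.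
by rewrite updE eq_sym bout sg0.
Qed.

Lemma compile_prec n (g : recfun n) (h : recfun n.+2) :
  compile_spec g -> compile_spec h -> compile_spec (RPrec g h).
Proof.
move=> IHg IHh ins out b sg tau [lt_ins lt_out out_ins out0 sg0].
set xs := [tuple of behead (map_tuple sg ins)]; set K := sg (thead ins).
have theadin : thead ins \in val ins by apply: mem_tnth.
have thead_lt : thead ins < b by apply: (allP lt_ins).
have thead_out : thead ins != out by apply: contraNneq out_ins => <-.
have beh_in r : r \in behead ins -> r \in val ins by apply: mem_behead.
have lt_beh r : r \in behead ins -> r < b by move/beh_in/(allP lt_ins).
have out_beh : out \notin behead ins by apply: contra out_ins => /beh_in.
pose st i z := upd (upd (upd sg out z) b i) b.+1 (K - i).
have gE rho : den (compile g [tuple of behead ins] out b) sg rho <->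
    exists2 z, computes g xs z & rho = upd sg out z.
  by rewrite IHg /xs ?behead_map_tuple //; split=> //; apply/allP => r /lt_beh.
have copyE z rho : den (copy_reg (thead ins) b.+1 b.+2) (upd sg out z) rho <->
    rho = st 0 z.
  rewrite den_copy; try lia.
    suff -> : upd (upd sg out z) b.+1 (upd sg out z b.+1 + upd sg out z (thead ins)) = st 0 z by [].
    have b0 := sg0 b (leqnn _); have b1 := sg0 b.+1 (leqnSn _).
    rewrite /st /K (updE _ _ _ (thead ins)) (negbTE thead_out).
    by store_eq.
  by rewrite updE; case: eqVneq => [E|_]; [lia|apply: sg0; lia].
pose body := Seq (Do (Dec b.+1))
  (Seq (compile h [tuple of b :: out :: behead ins] b.+2 b.+3)
     (Seq (clear out) (Seq (move_reg b.+2 out) (Do (Inc b))))).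
have bodyE i z rho : den body (st i z) rho <-> i < K /\
    exists2 y, computes h [tuple of i :: z :: xs] y & rho = st i.+1 y.
  have stb1 : st i z b.+1 = K - i by rewrite /st updE eqxx.
  pose st' := upd (upd (upd sg out z) b i) b.+1 (K - i.+1).
  have hE rho' : den (compile h [tuple of b :: out :: behead ins] b.+2 b.+3) st' rho' <->
      exists2 y, computes h [tuple of i :: z :: xs] y & rho' = upd st' b.+2 y.
    rewrite IHh.
      suff -> : map_tuple st' [tuple of b :: out :: behead ins] = [tuple of i :: z :: xs] by [].
      apply: val_inj; rewrite /xs /= behead_map; congr [:: _, _ & _].
      - by rewrite /st' !updE; case: eqVneq => [|_]; [lia|rewrite eqxx].
      - by rewrite /st' !updE; do 2 (case: eqVneq => [|_]; [lia|]); rewrite eqxx.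
      apply/eq_in_map => r rin; have := lt_beh _ rin; rewrite /st' !updE => ltr.
      do 2 (case: eqVneq => [|_]; [lia|]); case: eqVneq => // E.
      by move: out_beh; rewrite -E rin.
    split=> //=.
    - by apply/and3P; split; try lia; apply/allP => r /lt_beh /=; lia.
    - by rewrite !inE !negb_or; apply/and3P; split; try lia; apply/negP => /lt_beh; lia.
    - by rewrite /st' !updE; do 3 (case: eqVneq => [|_]; [lia|]); apply: sg0; lia.
    - move=> r ltr; rewrite /st' !updE.
      by do 3 (case: eqVneq => [|_]; [lia|]); apply: sg0; lia.
  have b20 : sg b.+2 = 0 by apply: sg0; lia.
  have decE rho' : den (Do (Dec b.+1)) (st i z) rho' <-> i < K /\ rho' = st'.
    rewrite /= stb1.
    have -> : upd (st i z) b.+1 (K - i).-1 = st' by rewrite /st /st' updK subnS.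
    by rewrite subn_gt0.
  have tailE y : upd (upd (upd (upd st' b.+2 y) out 0) out (0 + y)) b.+2 0 = 
     upd st' out y.
    by have b2 : st' b.+2 = 0; [rewrite /st' !updE; do 3 (case: eqVneq => [|_]; [lia|])|store_eq].
  have movE y rho' : den (move_reg b.+2 out) (upd (upd st' b.+2 y) out 0) rho' <->
     rho' = upd st' out y.
    have b2out : b.+2 != out by lia.
    rewrite den_move // -tailE.
    have -> : upd (upd st' b.+2 y) out 0 out = 0 by rewrite updE eqxx.
    by have -> : upd (upd st' b.+2 y) out 0 b.+2 = y by rewrite !updE (negbTE b2out) eqxx.
  have incE y : upd (upd st' out y) b (upd st' out y b).+1 = st i.+1 y.
    have -> : upd st' out y b = i.
      by rewrite /st' !updE; do 2 (case: eqVneq => [|_]; [lia|]); rewrite eqxx.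
    by rewrite /st /st'; store_eq.
  split.
    move=> [_ /decE[iK ->] [_ /hE[y Hy ->] [_ /den_clear-> [_ /movE -> /= ->]]]].
    by split=> //; exists y.
  move=> [iK [y Hy ->]]; exists st'; first exact/decE.
  exists (upd st' b.+2 y); first by apply/hE; exists y.
  exists (upd (upd st' b.+2 y) out 0); first exact/den_clear.
  by exists (upd st' out y); [apply/movE|rewrite /= incE].
have stK z : upd (st K z) b 0 = upd sg out z.
  have b0 := sg0 b (leqnn _); have b1 := sg0 b.+1 (leqnSn _).
  by rewrite /st subnn; store_eq.
have loop i z rho : star (den body) (st i z) rho ->
    prec_graph (computes g) (computes h) i xs z -> i <= K ->
    exists i' z', [/\ i' <= K, rho = st i' z'
      & prec_graph (computes g) (computes h) i' xs z'].
  move E: (st i z) => s0 Hs; elim: Hs i z E => {s0 rho} [s0|s0 s1 s2 Hb _ IHs] i z E Hz iK.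
    by exists i, z.
  subst s0; have [ltiK [y Hy E]] := (bodyE _ _ _).1 Hb.
  by apply: (IHs _ _ (esym E)) => //; exists z.
have -> : computes (RPrec g h) (map_tuple sg ins) =
   prec_graph (computes g) (computes h) K xs.
  by rewrite /= thead_map.
split.
  move=> [_ /gE[z Hz ->] [_ /copyE-> [_ [rho Hs [rho0 ->]] /den_clear ->]]].
  have [i [y [iK E Hy]]] := loop _ _ _ Hs Hz (leq0n _); subst rho.
  have Ei : i = K by move: rho0; rewrite /st updE eqxx; lia.
  by subst i; exists y.
move=> [y Hy ->].
have [z Hz Hs] : exists2 z, computes g xs z & star (den body) (st 0 z) (st K y).
  elim: {-2}K (leqnn K) y Hy => [|i IHi] iK y /=.
    by exists y => //; apply: star_refl.
  move=> [z Hz Hy]; have [z0 Hz0 Hs] := IHi (ltnW iK) _ Hz; exists z0 => //.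
  by apply: star_trans Hs (star1 _); apply/bodyE; split=> //; exists y.
exists (upd sg out z); first by apply/gE; exists z.
exists (st 0 z); first exact/copyE.
exists (st K y); last by apply/den_clear.
by exists (st K y) => //=; rewrite /st updE eqxx subnn.
Qed.

Definition set_regs m b (z : 'I_m -> nat) (s : seq 'I_m) sg : store :=
  foldl (fun sg' (i : 'I_m) => upd sg' (b + i) (z i)) sg s.

Lemma set_regsE m b (z : 'I_m -> nat) (s : seq 'I_m) sg r :
  set_regs b z s sg r = 
  if [pick i in s | b + i == r] is Some i then z i else sg r.
Proof.
elim: s sg => [|i s IH] sg /=; first by case: pickP.
rewrite IH; case: pickP => [j /andP[js /eqP E]|none].
  case: pickP => [j' /andP[_ /eqP E']|/(_ j)].
    by congr z; apply: val_inj; move: E E' => /=; lia.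
  by rewrite inE js E eqxx orbT.
rewrite updE; case: eqVneq => [E|Nr].
  case: pickP => [j' /andP[_ /eqP E']|/(_ i)].
    by congr z; apply: val_inj; move: E E' => /=; lia.
  by rewrite inE eqxx E eqxx.
case: pickP => [j' /andP[+ E']|//].
rewrite inE => /predU1P[E|j's].
  by move: E'; rewrite E eq_sym (negbTE Nr).
by have := none j'; rewrite /= j's E'.
Qed.

Lemma set_regs_in m b (z : 'I_m -> nat) (s : seq 'I_m) sg (i : 'I_m) : i \in s ->
  set_regs b z s sg (b + i) = z i.
Proof.
move=> is_; rewrite set_regsE; case: pickP => [j /andP[_ /eqP E]|/(_ i)].
  by congr z; apply: val_inj => /=; lia.
by rewrite /= is_ eqxx.
Qed.

Lemma set_regs_out m b (z : 'I_m -> nat) (s : seq 'I_m) sg r : r < b \/ b + m <= r ->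
  set_regs b z s sg r = sg r.
Proof.
move=> Hr; rewrite set_regsE; case: pickP => // j /andP[_ /eqP E].
by have := ltn_ord j; lia.
Qed.

Lemma den_clears m b (s : seq 'I_m) sg tau :
  den (seqs [seq clear (b + i) | i : 'I_m <- s]) sg tau <->
  tau = set_regs b (fun=> 0) s sg.
Proof.
elim: s sg => [|i s IH] sg //=.
split=> [[_ /den_clear -> /IH //]|E].
by exists (upd sg (b + i) 0); [apply/den_clear|apply/IH].
Qed.

Lemma den_compiles m n (h : 'I_m -> recfun n) (ins : n.-tuple nat) b (s : seq 'I_m) sg tau :
    (forall i, compile_spec (h i)) -> uniq s -> all (fun r => r < b) ins ->
    (forall r, b + m <= r -> sg r = 0) ->
    (forall i, i \in s -> sg (b + i) = 0) ->
  den (seqs [seq compile (h i) ins (b + i) (b + m) | i <- s]) sg tau <->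
  exists2 z : 'I_m -> nat,
    (forall i, i \in s -> computes (h i) (map_tuple sg ins) (z i))
    & tau = set_regs b z s sg.
Proof.
move=> Hh; elim: s sg tau => [|i s IH] sg tau /=.
  by move=> *; split=> [->|[z _ ->//]]; exists (fun=> 0).
move=> /andP[i_s us] lt_ins sg0 sgs.
have bi_ins : b + i \notin ins by apply/negP => /(allP lt_ins); lia.
have hE rho : den (compile (h i) ins (b + i) (b + m)) sg rho <->
    exists2 y, computes (h i) (map_tuple sg ins) y & rho = upd sg (b + i) y.
  apply: Hh; split=> //.
  - by apply/allP => r /(allP lt_ins); lia.
  - by rewrite ltn_add2l.
  - by apply: sgs; rewrite mem_head.
have restE y tau' := IH (upd sg (b + i) y) tau' us lt_ins.
have upd_ready y : (forall r, b + m <= r -> upd sg (b + i) y r = 0) /\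
    (forall j, j \in s -> upd sg (b + i) y (b + j) = 0).
  split=> [r ltr|j js]; rewrite updE.
    by case: eqVneq => [E|_]; [have := ltn_ord i; lia|apply: sg0].
  case: eqVneq => [E|_]; last by apply: sgs; rewrite inE js orbT.
  by have Eji : j = i; [apply: val_inj => /=; lia|rewrite -Eji js in i_s].
split.
  move=> [rho /hE[y Hy ->]] /restE[||z Hz ->]; try by case: (upd_ready y).
  exists (fun j => if j == i then y else z j).
    move=> j; rewrite inE; case: eqVneq => [-> _|_ /= js]; first done.
    by have := Hz _ js; rewrite map_upd.
  rewrite /set_regs /= eqxx; apply: funext => r.
  rewrite -!/(set_regs _ _ _ _) !set_regsE; case: pickP => // j /andP[js _].
  by case: eqVneq => // Eji; rewrite -Eji js in i_s.
move=> [z Hz ->]; exists (upd sg (b + i) (z i)).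
  by apply/hE; exists (z i) => //; apply: Hz; rewrite mem_head.
apply/restE; try by case: (upd_ready (z i)).
by exists z => // j js; rewrite map_upd //; apply: Hz; rewrite inE js orbT.
Qed.

Lemma compile_comp m n (g : recfun m) (h : 'I_m -> recfun n) :
  compile_spec g -> (forall i, compile_spec (h i)) -> compile_spec (RComp g h).
Proof.
move=> IHg IHh ins out b sg tau [lt_ins lt_out out_ins out0 sg0].
set xs := map_tuple sg ins.
have inE i : i \in enum 'I_m by rewrite mem_enum.
pose st z := set_regs b z (enum 'I_m) sg.
have hE rho : den (seqs [seq compile (h i) ins (b + i) (b + m) | i <- enum 'I_m]) sg rho <->
    exists2 z : 'I_m -> nat, (forall i, computes (h i) xs (z i)) & rho = st z.
  have sgm r : b + m <= r -> sg r = 0 by move=> ?; apply: sg0; lia.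
  have sgi i : i \in enum 'I_m -> sg (b + i) = 0 by move=> _; apply: sg0; lia.
  rewrite (den_compiles _ IHh (enum_uniq _) lt_ins sgm sgi).
  by split=> [] [z Hz ->]; exists z => // i; apply: Hz.
have gE z rho : den (compile g [tuple b + i | i < m] out (b + m)) (st z) rho <->
    exists2 y, computes g [tuple z i | i < m] y & rho = upd (st z) out y.
  rewrite IHg.
    suff -> : map_tuple (st z) [tuple b + i | i < m] = [tuple z i | i < m] by [].
    by apply: eq_from_tnth => i; rewrite tnth_map !tnth_mktuple /st set_regs_in.
  split=> /=.
  - by apply/allP => _ /mapP[i _ ->] /=; have := ltn_ord i; lia.
  - lia.
  - by apply/negP => /mapP[i _ E]; lia.
  - by rewrite /st set_regs_out //; left.
  - by move=> r ltr; rewrite /st set_regs_out; [apply: sg0; lia|right].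
have clrE z y : set_regs b (fun=> 0) (enum 'I_m) (upd (st z) out y) = upd sg out y.
  apply: funext => r; have [|ltr] := boolP ((r < b) || (b + m <= r)).
    move=> /orP Hr; rewrite set_regs_out //= !updE; case: eqVneq => // _.
    by rewrite /st set_regs_out.
  have ltm : r - b < m by lia.
  have -> : r = b + Ordinal ltm by rewrite /=; lia.
  rewrite set_regs_in // updE; case: eqVneq => [/= E|_]; first lia.
  by rewrite sg0 //= leq_addr.
split=> /=.
  move=> [_ /hE[z Hz ->] [_ /gE[y Hy ->] /den_clears->]]; rewrite clrE.
  by exists y => //; exists [tuple z i | i < m] => // i; rewrite tnth_mktuple.
move=> [y [zs Hzs Hy] ->]; exists (st (tnth zs)); first by apply/hE; exists (tnth zs).
exists (upd (st (tnth zs)) out y); last by apply/den_clears; rewrite clrE.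
apply/gE; exists y => //.
by suff -> : [tuple tnth zs i | i < m] = zs by []; apply: eq_from_tnth => i; rewrite tnth_mktuple.
Qed.

Theorem compileP n (f : recfun n) : compile_spec f.
Proof.
elim: f => {n} [n|| n i|m n g IHg h IHh|n g IHg h IHh|n g IHg].
- move=> ins out b sg tau [_ _ _ out0 _] /=.
  by split=> [->|[_ -> ->]]; [exists 0 => //|]; rewrite upd0.
- move=> ins out b sg tau [lt_ins lt_out out_ins out0 sg0].
  have lt_t := allP lt_ins _ (mem_tnth ord0 ins).
  have t_out : thead ins != out by apply: contraNneq out_ins => <-; apply: mem_tnth.
  have copyE rho : den (copy_reg (thead ins) out b) sg rho <->
      rho = upd sg out (sg (thead ins)).
    have tb : thead ins != b by apply/eqP => E; move: lt_t; rewrite /= -[tnth _ _]/(thead ins) E ltnn.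
    have outb : out != b by lia.
    by rewrite (den_copy _ t_out tb outb (sg0 _ (leqnn _))) out0.
  rewrite /= thead_map; split.
    by move=> [_ /copyE-> ->]; exists (sg (thead ins)).+1 => //; store_eq.
  move=> [_ -> ->]; exists (upd sg out (sg (thead ins))); first exact/copyE.
  by rewrite updE eqxx updK.
- move=> ins out b sg tau [lt_ins lt_out out_ins out0 sg0].
  have lt_t := allP lt_ins _ (mem_tnth i ins).
  have t_out : tnth ins i != out by apply: contraNneq out_ins => <-; apply: mem_tnth.
  have tb : tnth ins i != b by apply/eqP => E; move: lt_t; rewrite /= E ltnn.
  have outb : out != b by lia.
  have copyE := den_copy tau t_out tb outb (sg0 _ (leqnn _)).
  rewrite out0 in copyE; split=> [/copyE->|[_ /= -> E]].
    by exists (sg (tnth ins i)) => //=; rewrite tnth_map.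
  by apply/copyE; rewrite E tnth_map.
- exact: compile_comp.
- exact: compile_prec.
- exact: compile_mu.
Qed.

Definition input n : store := upd (fun=> 0) 0 n.

Definition zero_test (g : recfun 1) : prog :=
  Seq (compile g [tuple 0] 1 2) (Do (Zero 1)).

Lemma zero_testP (g : recfun 1) n :
  (exists tau, den (zero_test g) (input n) tau) <-> computes g [tuple n] 0.
Proof.
have gE rho : den (compile g [tuple 0] 1 2) (input n) rho <->
    exists2 y, computes g [tuple n] y & rho = upd (input n) 1 y.
  rewrite compileP.
    suff -> : map_tuple (input n) [tuple 0] = [tuple n] by [].
    exact: val_inj.
  by split=> // -[|r].
split=> [[_ [_ /gE[y Hy ->] [/= y0 _]]]|Hy].
  have {}y0 : y = 0 by []; by rewrite y0 in Hy.
by exists (upd (input n) 1 0), (upd (input n) 1 0) => //; apply/gE; exists 0.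
Qed.

HB.instance Definition _ := gen_eqMixin op.
HB.instance Definition _ := gen_eqMixin prog.

(* The control states of the machine executing a program are the stacks of
   programs that remain to be executed. *)
Definition stack := seq prog.

Definition succs (s : stack) : seq (op * stack) :=
  match s with
  | [::] => [::]
  | Do o :: K => [:: (o, K)]
  | Seq p q :: K => [:: (Nop, p :: q :: K)]
  | Star p :: K => [:: (Nop, K); (Nop, p :: Star p :: K)]
  end.

Inductive reached (s0 : stack) (sg0 : store) : stack -> store -> Prop :=
| reached0 : reached s0 sg0 s0 sg0
| reachedS (s : stack) sg o (s' : stack) tau : reached s0 sg0 s sg -> (o, s') \in succs s ->
    op_step o sg tau -> reached s0 sg0 s' tau.

Fixpoint den_stack (K : stack) sg tau : Prop :=
  match K with
  | [::] => tau = sg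
  | p :: K' => exists2 rho, den p sg rho & den_stack K' rho tau
  end.

Lemma reached_den s0 sg0 (s : stack) sg tau :
  reached s0 sg0 s sg -> den_stack s sg tau -> den_stack s0 sg0 tau.
Proof.
elim=> // {}s {}sg o s' rho _ IH os' Ho Hs'; apply: IH.
case: s os' => // -[o1|p q|p] K; rewrite !inE /= => os'.
- by move/eqP: os' Ho Hs' => [-> ->]; exists rho.
- move/eqP: os' Ho Hs' => [-> ->] /= -> [rho1 H1 [rho2 H2 H3]].
  by exists rho2 => //; exists rho1.
- case/orP: os' Ho Hs' => /eqP[-> ->] /= ->.
    by move=> HK; exists sg => //; apply: star_refl.
  by move=> [rho1 H1 [rho2 H2 H3]]; exists rho2 => //; apply: star_step H2.
Qed.

Lemma den_reached s0 sg0 p K sg tau :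
  den p sg tau -> reached s0 sg0 (p :: K) sg -> reached s0 sg0 K tau.
Proof.
elim: p K sg tau => [o|p IHp q IHq|p IHp] K sg tau /=.
- by move=> Ho H; apply: reachedS H _ Ho; rewrite inE.
- move=> [rho Hp Hq] H; apply: IHq Hq (IHp _ _ _ Hp _).
  by apply: reachedS H (_ : (Nop, _) \in _) (erefl sg); rewrite inE.
- elim=> {sg tau} [sg H|sg rho tau Hp _ IH H].
    by apply: reachedS H (_ : (Nop, _) \in _) (erefl sg); rewrite inE eqxx.
  apply/IH/(IHp _ _ _ Hp).
  by apply: reachedS H (_ : (Nop, _) \in _) (erefl sg); rewrite !inE eqxx orbT.
Qed.

Lemma reachedP p sg :
  (exists tau, reached [:: p] sg [::] tau) <-> exists tau, den p sg tau.
Proof.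
split=> -[tau H]; exists tau.
  by have [rho Hp ->] := reached_den H (erefl tau).
by apply: den_reached H _; apply: reached0.
Qed.

Fixpoint stacks p (K : stack) : seq stack :=
  (p :: K) :: match p with
  | Do _ => [::]
  | Seq p1 p2 => stacks p1 (p2 :: K) ++ stacks p2 K
  | Star p1 => stacks p1 (p :: K)
  end.

Lemma stacks_head p K : p :: K \in stacks p K.
Proof. by case: p => *; rewrite /= mem_head. Qed.

Lemma stacks_succs p K (s : stack) o (s' : stack) :
  s \in stacks p K -> (o, s') \in succs s -> s' \in K :: stacks p K.
Proof.
elim: p K => [o1|p1 IH1 p2 IH2|p1 IH1] K /=.
- by rewrite inE => /eqP-> /=; rewrite !inE => /eqP[_ ->]; rewrite eqxx.
- rewrite in_cons => /predU1P[->|].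
    by rewrite /= !inE => /eqP[_ ->]; rewrite mem_cat stacks_head !orbT.
  rewrite mem_cat => /orP[/IH1 H|/IH2 H] /H.
    by rewrite !inE mem_cat => /predU1P[->|->]; rewrite ?stacks_head ?orbT.
  by rewrite !inE mem_cat => /predU1P[->|->]; rewrite ?eqxx ?orbT.
- rewrite in_cons => /predU1P[->|/IH1 H /H].
    rewrite /= !inE => /orP[] /eqP[_ ->]; first by rewrite eqxx.
    by rewrite stacks_head !orbT.
  by rewrite !inE => /predU1P[->|->]; rewrite ?eqxx ?orbT.
Qed.

(** * Automata whose actions occur in cyclic order *)

Local Open Scope ring_scope.
Import Order.TTheory GRing.Theory Num.Theory.

Definition term : Type := ('I_2 + int)%type.
Definition pguard : Type := seq (nat * cmp * term).
Definition pedge : Type := (nat * pguard * nat * nat)%type.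

Definition mk_guard N (g : pguard) : guard 'I_N.+1 term :=
  [seq (inord c.1.1, c.1.2, c.2) | c <- g].

Definition mk_edge N (e : pedge) : edge 'I_N.+1 'I_N.+1 term :=
  Edge (inord e.1.1.1) (mk_guard N e.1.1.2) (inord e.1.2) (inord e.2).

Definition node_loc (v : nat) : nat := code [:: v].
Definition mid_loc (t j : nat) : nat := code [:: t; j].

Lemma node_loc_inj : injective node_loc.
Proof. by move=> v v' /code_inj[]. Qed.

Lemma mid_loc_inj t j t' j' : mid_loc t j = mid_loc t' j' -> t = t' /\ j = j'.
Proof. by move/code_inj => [-> ->]. Qed.

Lemma node_mid v t j : node_loc v <> mid_loc t j.
Proof. by move/code_inj. Qed.

Definition cycle_arc : Type := (nat * (nat -> pguard) * nat)%type.

Section CyclicPera.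
Variables (k : nat) (arcs : seq cycle_arc).

Definition arc_at t : cycle_arc := nth (0%N, fun=> [::], 0%N) arcs t.
Definition asrc t : nat := (arc_at t).1.1.
Definition agrd t : nat -> pguard := (arc_at t).1.2.
Definition atgt t : nat := (arc_at t).2.

Definition esrc t j : nat := if j == 0%N then node_loc (asrc t) else mid_loc t j.
Definition etgt t j : nat := if j == k then node_loc (atgt t) else mid_loc t j.+1.

Definition pedges : seq pedge :=
  [seq (esrc t j, agrd t j, j, etgt t j) | t <- iota 0 (size arcs), j <- iota 0 k.+1].

Definition cyclic_pera N : pera 'I_N.+1 'I_N.+1 'I_2 :=
  Automaton (inord (node_loc 0)) [ffun=> [::]] (map (mk_edge N) pedges)
    [set inord (node_loc 2)].

Variables (R : realType) (N : nat) (v : param_valuation 'I_2).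

Hypothesis leN : (k <= N)%N.
Hypothesis src_le : forall t j, (t < size arcs)%N -> (j <= k)%N -> (esrc t j <= N)%N.
Hypothesis tgt_le : forall t j, (t < size arcs)%N -> (j <= k)%N -> (etgt t j <= N)%N.
Hypothesis init_le : (node_loc 0 <= N)%N.
Hypothesis halt_le : (node_loc 2 <= N)%N.
Hypothesis vars_le : forall t j c, (t < size arcs)%N -> (j <= k)%N ->
  c \in agrd t j -> (c.1.1 <= k)%N.

Definition holds (x : nat -> R) (g : pguard) : bool :=
  all (fun c => cmp_holds c.1.2 (x c.1.1) (ratr (inst_term v c.2))) g.

Definition now (e : nat -> R) (j : nat) : R := if j is j'.+1 then e j' else 0.

(* Clock values at time [u] of a cycle in which the events [a_0 .. a_(j-1)]
   have already happened, at times [e 0 .. e (j-1)]; [S] gives the values at the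
   beginning of the cycle. *)
Definition clocks (S e : nat -> R) j u : nat -> R :=
  fun l => if (l < j)%N then u - e l else S l + u.

Definition cycle_step (S : nat -> R) (g : nat -> pguard) (S' : nat -> R) : Prop :=
  exists e : nat -> R,
    (forall j, (j <= k)%N -> now e j <= e j /\ holds (clocks S e j (e j)) (g j)) /\
    (forall l, (l <= k)%N -> S' l = e k - e l).

Inductive node_reached : nat -> (nat -> R) -> Prop :=
| node_reached0 : node_reached 0 (fun=> 0)
| node_reachedS t S S' : node_reached (asrc t) S -> (t < size arcs)%N ->
    cycle_step S (agrd t) S' -> node_reached (atgt t) S'.

Let A := inst v (cyclic_pera N).
Let state : Type := ('I_N.+1 * clock_valuation R 'I_N.+1)%type.
Implicit Types st : state.

Definition nonneg st : Prop := forall a, 0 <= st.2 a.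
Definition agree (mu : clock_valuation R 'I_N.+1) (x : nat -> R) : Prop :=
  forall l, (l <= k)%N -> mu (inord l) = x l.

Lemma is_stateE st : is_state A st <-> nonneg st.
Proof. by rewrite /is_state /= !ffunE /=; split=> [[]|]. Qed.

Lemma sat_holds mu x g : (forall c, c \in g -> (c.1.1 <= k)%N) -> agree mu x ->
  satisfies mu (inst_guard v (mk_guard N g)) = holds x g.
Proof.
move=> gk mux; rewrite /satisfies /inst_guard /mk_guard /holds !all_map.
by apply: eq_in_all => c /gk ck /=; rewrite mux.
Qed.

Definition step st st' (e : edge 'I_N.+1 'I_N.+1 rat) : Prop :=
  exists d, exists2 t, delay_step A d st t & discrete_step A e t st'.

Lemma stepP st st' e : step st st' e -> exists t j (d : R),
  [/\ [/\ (t < size arcs)%N, (j <= k)%N & 0 <= d],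
      label e = inord j, st.1 = inord (esrc t j), st'.1 = inord (etgt t j)
    & [/\ satisfies (shift st.2 d) (inst_guard v (mk_guard N (agrd t j))),
         st'.2 = reset (shift st.2 d) (inord j) & nonneg st']].
Proof.
move=> [d [_ [d0 -> _] [_ /is_stateE st'0 /mapP[_ /mapP[_ /allpairsP[[t j] [tin jin ->]] ->] ->]]]].
rewrite mem_iota add0n ltnS /= in jin; rewrite mem_iota add0n /= in tin.
by move=> /= [-> ->] [sat ->]; exists t, j, d.
Qed.

Lemma step_intro st t j (d : R) : (t < size arcs)%N -> (j <= k)%N -> 0 <= d ->
    nonneg st -> st.1 = inord (esrc t j) ->
    satisfies (shift st.2 d) (inst_guard v (mk_guard N (agrd t j))) ->
  exists e, step st (inord (etgt t j), reset (shift st.2 d) (inord j)) e.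
Proof.
move=> tA jk d0 st0 Est sat.
have sh0 d' : 0 <= d' -> nonneg (st.1, shift st.2 d').
  by move=> d'0 a; rewrite ffunE addr_ge0.
exists (inst_edge v (mk_edge N (esrc t j, agrd t j, j, etgt t j))), d.
exists (st.1, shift st.2 d).
  by split=> // d' /andP[d'0 _]; apply/is_stateE/sh0.
split=> //.
- by apply/is_stateE/sh0.
- by apply/is_stateE => a; rewrite !ffunE; case: eqP => // _; rewrite addr_ge0.
- by apply/map_f/map_f/allpairsP; exists (t, j); rewrite !mem_iota !add0n ltnS.
Qed.

Lemma inord_le_inj m n : (m <= N)%N -> (n <= N)%N ->
  inord m = inord n :> 'I_N.+1 -> m = n.
Proof. by move=> mN nN /(congr1 val); rewrite /= !inordK ?ltnS. Qed.

Lemma agree_shift mu S e j (u d : R) : agree mu (clocks S e j u) ->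
  agree (shift mu d) (clocks S e j (u + d)).
Proof.
move=> H l lk; rewrite ffunE H // /clocks.
by case: ifP => _; rewrite ?addrA // addrAC.
Qed.

Lemma agree_reset mu S e j : (j <= k)%N -> agree mu (clocks S e j (e j)) ->
  agree (reset mu (inord j)) (clocks S e j.+1 (e j)).
Proof.
move=> jk H l lk; rewrite ffunE; case: eqVneq => [|Nlj].
  move/inord_le_inj => ->; try exact: leq_trans leN.
  by rewrite /clocks ltnSn subrr.
have {}Nlj : l <> j by move=> E; rewrite E eqxx in Nlj.
rewrite H // /clocks ltnS (leq_eqVlt l j).
by move/eqP/negbTE: Nlj => ->.
Qed.

Lemma eq_clocks S e e' j u : (forall i, (i < j)%N -> e i = e' i) ->
  clocks S e j u = clocks S e' j u.
Proof.
by move=> H; apply: funext => l; rewrite /clocks; case: ifP => // /H ->.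
Qed.

Definition good_prefix (S e : nat -> R) t j : Prop :=
  forall i, (i < j)%N -> now e i <= e i /\ holds (clocks S e i (e i)) (agrd t i).

Definition at_phase (j : nat) st : Prop :=
  if j == 0%N then
    exists n S, [/\ st.1 = inord (node_loc n), (node_loc n <= N)%N,
      node_reached n S & agree st.2 S]
  else exists t S e, [/\ (t < size arcs)%N, st.1 = inord (mid_loc t j),
      node_reached (asrc t) S, good_prefix S e t j & agree st.2 (clocks S e j (now e j))].

Lemma advance st st' t S e j d :
    (t < size arcs)%N -> (j <= k)%N -> 0 <= d -> node_reached (asrc t) S ->
    good_prefix S e t j -> agree st.2 (clocks S e j (now e j)) ->
    satisfies (shift st.2 d) (inst_guard v (mk_guard N (agrd t j))) ->
    st'.1 = inord (etgt t j) -> st'.2 = reset (shift st.2 d) (inord j) ->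
  at_phase (if j == k then 0 else j.+1) st'.
Proof.
move=> tA jk d0 HS He Hst sat E1 E2.
pose e' i := if i == j then now e j + d else e i.
have e'j : e' j = now e j + d by rewrite /e' eqxx.
have e'lt i : (i < j)%N -> e i = e' i by rewrite /e' => /ltn_eqF ->.
have nowE i : (i <= j)%N -> now e i = now e' i by case: i => //= i /e'lt.
have agr : agree (shift st.2 d) (clocks S e' j (e' j)).
  by rewrite -(eq_clocks _ _ e'lt) e'j; apply: agree_shift.
have He' : good_prefix S e' t j.+1.
  move=> i; rewrite ltnS leq_eqVlt => /predU1P[->|ij].
    rewrite -nowE // e'j lerDl -e'j; split=> //.
    by rewrite -(sat_holds _ agr) // => c; apply: vars_le.
  have e'li l : (l < i)%N -> e l = e' l by move=> li; apply: e'lt; apply: ltn_trans ij.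
  by rewrite -nowE ?(ltnW ij) // -(eq_clocks _ _ e'li) -e'lt //; apply: He.
have agr' : agree st'.2 (clocks S e' j.+1 (e' j)) by rewrite E2; apply: agree_reset.
have [Ej|Njk] := eqVneq j k; rewrite /at_phase /=.
  exists (atgt t), (fun l => e' k - e' l).
  have tgtE : etgt t j = node_loc (atgt t) by rewrite /etgt Ej eqxx.
  split; rewrite -?tgtE //; first exact: tgt_le.
    apply: node_reachedS HS tA _; exists e'; split=> // i ik.
    by apply: He'; rewrite Ej ltnS.
  by move=> l lk; rewrite agr' // /clocks Ej ltnS lk.
exists t, S, e'; split=> //.
by rewrite E1 /etgt (negbTE Njk).
Qed.

Lemma phase_step j st st' e : (j <= k)%N -> at_phase j st -> step st st' e ->
  label e = inord j /\ at_phase (if j == k then 0 else j.+1) st'.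
Proof.
move=> jk Hj /stepP[t [j' [d [[tA j'k d0] le Es Et [sat E2 _]]]]].
have Hloc := src_le tA j'k.
move: Hj; rewrite /at_phase; case: (eqVneq j 0%N) => [j0|jN0].
  move=> [n [S [En nN HS Hst]]].
  have := inord_le_inj Hloc nN (etrans (esym Es) En).
  rewrite /esrc; case: eqVneq => [j'0 /node_loc_inj En'|_ /esym/node_mid //].
  subst n j j'; split=> //; apply: (advance (e := fun=> 0) tA jk d0 HS) sat Et E2 => //.
  by move=> l lk; rewrite Hst // /clocks ltn0 addr0.
move=> [t' [S [e' [t'A En HS He' Hst]]]].
have mN : (mid_loc t' j <= N)%N.
  by have := src_le t'A jk; rewrite /esrc (negbTE jN0).
have := inord_le_inj Hloc mN (etrans (esym Es) En).
rewrite /esrc; case: eqVneq => [_ /node_mid //|_ /mid_loc_inj[Et' Ej]].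
by subst t' j'; split=> //; apply: (advance tA jk d0 HS He' Hst sat Et E2).
Qed.

Lemma run_phase (s : nat -> state) (d : nat -> R) e i : infinite_run A s d e -> at_phase (i %% k.+1)%N (s i).
Proof.
move=> [s0 _ Hs]; elim: i => [|i IH].
  rewrite mod0n s0; exists 0%N, (fun=> 0); split=> //; first exact: node_reached0.
  by move=> l _; rewrite ffunE.
have jk : (i %% k.+1 <= k)%N by rewrite -ltnS ltn_pmod.
have st : step (s i) (s i.+1) (e i) by exists (d i).
have [_] := phase_step jk IH st.
suff -> : (i.+1 %% k.+1 = if i %% k.+1 == k then 0 else (i %% k.+1).+1)%N by [].
rewrite -addn1 -modnDml; case: eqP => [->|/eqP ik]; first by rewrite addn1 modnn.
by rewrite modn_small addn1 // ltnS ltn_neqAle ik.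
Qed.

Lemma run_label (s : nat -> state) (d : nat -> R) e i : infinite_run A s d e -> label (e i) = inord (i %% k.+1)%N.
Proof.
move=> Hr; have [_ _ Hs] := Hr.
have st : step (s i) (s i.+1) (e i) by exists (d i).
have jk : (i %% k.+1 <= k)%N by rewrite -ltnS ltn_pmod.
by have [] := phase_step jk (run_phase i Hr) st.
Qed.

Lemma accepted_reached (s : nat -> state) (d : nat -> R) e : infinite_run A s d e -> buchi_accepting A s ->
  exists S, node_reached 2 S.
Proof.
move=> Hr /(_ 0%N)[m _]; rewrite inE => /eqP Em.
have := run_phase m Hr; rewrite /at_phase.
have jk : (m %% k.+1 <= k)%N by rewrite -ltnS ltn_pmod.
case: eqVneq => [_ [n [S [En nN HS _]]]|jN0 [t [S [e' [tA En _ _ _]]]]].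
  have := inord_le_inj halt_le nN (etrans (esym Em) En).
  by move/node_loc_inj => E; rewrite -E in HS; exists S.
have mN : (mid_loc t (m %% k.+1) <= N)%N.
  by have := src_le tA jk; rewrite /esrc (negbTE jN0).
by have := inord_le_inj halt_le mN (etrans (esym Em) En) => /node_mid.
Qed.

Fixpoint reaches_halt n st : Prop :=
  if n is n'.+1 then exists st' e, step st st' e /\ reaches_halt n' st'
  else st.1 = inord (node_loc 2) /\ nonneg st.

Lemma event_step st t S e j : (t < size arcs)%N -> (j <= k)%N ->
    now e j <= e j -> holds (clocks S e j (e j)) (agrd t j) ->
    st.1 = inord (esrc t j) -> nonneg st ->
    agree st.2 (clocks S e j (now e j)) ->
  exists st' e', [/\ step st st' e', st'.1 = inord (etgt t j), nonneg st'
    & agree st'.2 (clocks S e j.+1 (e j))].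
Proof.
move=> tA jk nowj Hj E st0 Hst.
have d0 : 0 <= e j - now e j by rewrite subr_ge0.
have agr : agree (shift st.2 (e j - now e j)) (clocks S e j (e j)).
  by rewrite -{2}(subrKC (now e j) (e j)); apply: agree_shift.
have vars c : c \in agrd t j -> (c.1.1 <= k)%N by apply: vars_le.
have [e' He'] := step_intro tA jk d0 st0 E (etrans (sat_holds vars agr) Hj).
have [_ [_ [_ [_ _ _ _ [_ _ st'0]]]]] := stepP He'.
exists (inord (etgt t j), reset (shift st.2 (e j - now e j)) (inord j)), e'.
by split=> //; apply: agree_reset.
Qed.

Lemma reaches_halt_cycle t S e n :
    (t < size arcs)%N -> good_prefix S e t k.+1 ->
    (forall st, st.1 = inord (node_loc (atgt t)) -> nonneg st ->
      agree st.2 (fun l => e k - e l) -> reaches_halt n st) ->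
  forall m j st, (j + m)%N = k -> st.1 = inord (esrc t j) -> nonneg st ->
    agree st.2 (clocks S e j (now e j)) -> reaches_halt (n + m).+1 st.
Proof.
move=> tA He Hn m j st jm E st0 Hst.
have jk : (j <= k)%N by rewrite -jm leq_addr.
have [nowj Hj] := He j jk.
have [st' [e' [Hs E' st'0 Hst']]] := event_step tA jk nowj Hj E st0 Hst.
exists st', e'; split=> //.
elim: m => [|m IH] in j st st' e' jm E st0 Hst jk nowj Hj E' st'0 Hst' Hs *.
  have Ej : j = k by rewrite -jm addn0.
  rewrite addn0; apply: Hn => //; first by rewrite E' /etgt Ej eqxx.
  by move=> l lk; rewrite Hst' // /clocks Ej ltnS lk.
have jk' : (j < k)%N by lia.
have [nowj' Hj'] := He j.+1 jk'.
have E'' : st'.1 = inord (esrc t j.+1) by rewrite E' /etgt /esrc ltn_eqF.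
have [st2 [e2 [Hs2 E2 st20 Hst2]]] := event_step tA jk' nowj' Hj' E'' st'0 Hst'.
rewrite addnS; exists st2, e2; split=> //.
by apply: (IH j.+1 st' st2 e2) => //; lia.
Qed.

Lemma reached_halt n S : node_reached n S ->
    (exists m, forall st, st.1 = inord (node_loc n) -> nonneg st ->
       agree st.2 S -> reaches_halt m st) ->
  exists m, reaches_halt m (init_state R A).
Proof.
elim=> {n S} [[m Hm]|t S S' _ IH tA [e [He ES']] [m Hm]].
  by exists m; apply: Hm => // [a|l _]; rewrite ffunE.
apply: IH; exists (m + k).+1 => st E st0 Hst.
apply: (reaches_halt_cycle (t := t) (S := S) (e := e)) (add0n k) _ st0 _ => //.
  by move=> st' E' st'0 Hst'; apply: Hm => // l lk; rewrite Hst' // ES'.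
by move=> l lk; rewrite /clocks ltn0 addr0 Hst.
Qed.

Variable t0 : nat.
Hypothesis loop_lt : (t0 < size arcs)%N.
Hypothesis loop_src : asrc t0 = 2%N.
Hypothesis loop_tgt : atgt t0 = 2%N.
Hypothesis loop_grd : forall j, agrd t0 j = [::].

Lemma halt_again st : reaches_halt 0 st -> reaches_halt k.+1 st.
Proof.
move=> [E st0]; rewrite -[k]add0n.
apply: (reaches_halt_cycle (t := t0) (S := fun l => st.2 (inord l)) (e := fun=> 0))
  (add0n k) _ st0 _ => //.
- by move=> i _; rewrite loop_grd; case: i.
- by rewrite loop_tgt.
- by rewrite /esrc /= loop_src.
- by move=> l lk; rewrite /clocks ltn0 addr0.
Qed.

Lemma halting_run n : reaches_halt n (init_state R A) ->
  exists (s : nat -> state) (d : nat -> R) e, infinite_run A s d e /\ buchi_accepting A s.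
Proof.
move=> H0; pose T := {x : nat * state | reaches_halt x.1 x.2}.
have next (x : T) : exists y : T,
    (exists e, step (sval x).2 (sval y).2 e) /\
    (forall m, (sval x).1 = m.+1 -> (sval y).1 = m).
  case: x => [[[|m] st] /= Hx].
    have [st' [e [Hs H']]] := halt_again Hx.
    by exists (exist _ (k, st') H'); split=> //; exists e.
  have [st' [e [Hs H']]] := Hx.
  by exists (exist _ (m, st') H'); split=> [|_ [<-]] //; exists e.
have [f Hf] := choice next.
pose x i := iter i f (exist _ (n, init_state R A) H0 : T).
pose s i := (sval (x i)).2.
have Hstep i : exists de : R * edge 'I_N.+1 'I_N.+1 rat,
    exists2 t, delay_step A de.1 (s i) t & discrete_step A de.2 t (s i.+1).
  by have [[e [d Hs]] _] := Hf (x i); exists (d, e).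
have [de Hde] := choice Hstep.
exists s, (fun i => (de i).1), (fun i => (de i).2); split.
  by split=> //; apply/is_stateE => a; rewrite ffunE.
move=> m; have rankE r i : (sval (x i)).1 = r -> (sval (x (i + r)%N)).1 = 0%N.
  elim: r i => [|r IH] i; first by rewrite addn0.
  move=> Ei; have [_ Hr] := Hf (x i); rewrite addnS -addSn; apply: IH.
  exact: Hr.
exists (m + (sval (x m)).1)%N; first exact: leq_addr.
have := rankE _ m erefl; rewrite /s; case: (x _) => [[r st] /= +] r0.
by rewrite r0 => -[/= -> _]; rewrite inE.
Qed.

Theorem cyclic_languageP w : untimed_buchi_language R A w <->
  w = (fun i => inord (i %% k.+1)%N) /\ exists S, node_reached 2 S.
Proof.
split=> [[s [d [e [Hr Hacc Hw]]]]|[-> [S HS]]].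
  split; last exact: accepted_reached Hr Hacc.
  by apply: funext => i; rewrite Hw; apply: run_label Hr.
have [|n Hn] := reached_halt HS; first by exists 0%N.
have [s [d [e [Hr Hacc]]]] := halting_run Hn.
by exists s, d, e; split=> // i; rewrite (run_label i Hr).
Qed.

End CyclicPera.

(** * Simulation of counter programs *)

Definition param_p : term := inl ord0.
Definition param_q : term := inl ord_max.
Definition cst (n : nat) : term := inr (Posz n).

Definition guard_eq (j : nat) (t : term) : pguard := [:: (j, Le, t); (j, Ge, t)].

Definition op_guard (o : op) (j : nat) : pguard :=
  match o with
  | Nop => guard_eq j param_p
  | Inc r => guard_eq j (if (j <= r)%N then param_p else param_q)
  | Dec r => guard_eq j (if (j <= r)%N then param_q else param_p)
  | Zero r => guard_eq j param_p ++ (if j == r.+1 then [:: (r, Le, cst 0)] else [::])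
  end.

Definition load_guard (n j : nat) : pguard :=
  match j with
  | 0 => guard_eq 0 param_p
  | 1 => guard_eq 0 (cst n)
  | j'.+2 => guard_eq j'.+1 (cst 0)
  end%N.

Definition check_guard (j : nat) : pguard :=
  match j with
  | 0 => guard_eq 0 param_p
  | 1 => guard_eq 1 param_q ++ guard_eq 0 (cst 1)
  | _ => guard_eq j param_q
  end%N.

Definition shortcut_guard (j : nat) : pguard :=
  if j == 0%N then [:: (0%N, Ge, param_p); (0%N, Ge, param_q); (0%N, Le, cst 0)]
  else [::].

Arguments holds : simpl never.

Section CycleSteps.
Variables (R : realType) (k : nat) (v : param_valuation 'I_2).
Let p : R := ratr (inst_term v param_p).
Let q : R := ratr (inst_term v param_q).
Implicit Types S e : nat -> R.

Lemma holds_cat (x : nat -> R) g g' : holds v x (g ++ g') = holds v x g && holds v x g'.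
Proof. by rewrite /holds all_cat. Qed.

Lemma holds_eq (x : nat -> R) j t :
  holds v x (guard_eq j t) = (x j == ratr (inst_term v t)).
Proof. by rewrite /holds /= andbT eq_le. Qed.

Lemma cst_val n : ratr (inst_term v (cst n)) = n%:R :> R.
Proof. exact: ratr_nat. Qed.

Lemma holds_le0 (x : nat -> R) r : holds v x [:: (r, Le, cst 0)] = (x r <= 0).
Proof. by rewrite /holds all_seq1 cst_val. Qed.

Lemma clocks_self S e j u : clocks S e j u j = S j + u.
Proof. by rewrite /clocks ltnn. Qed.

Lemma clocks_lt S e j u l : (l < j)%N -> clocks S e j u l = u - e l.
Proof. by rewrite /clocks => ->. Qed.

Definition tail_sum sg (l : nat) : R := (\sum_(l <= i < k) sg i)%:R.

Lemma tail_sumS sg l : (l < k)%N -> tail_sum sg l = (sg l)%:R + tail_sum sg l.+1.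
Proof. by move=> lk; rewrite /tail_sum big_ltn // natrD. Qed.

Lemma tail_sum_end sg : tail_sum sg k = 0.
Proof. by rewrite /tail_sum big_geq. Qed.

Lemma tail_sum_upd sg r x l : (r < k)%N ->
  tail_sum (upd sg r x) l =
  tail_sum sg l + (if (l <= r)%N then x%:R - (sg r)%:R else 0).
Proof.
move=> rk; rewrite /tail_sum; case: ifP => lr; last first.
  rewrite addr0; congr _%:R; apply: eq_big_nat => i /andP[li _].
  by rewrite updE; case: eqP => // E; rewrite E lr in li.
have rin : r \in index_iota l k by rewrite mem_index_iota lr.
rewrite !(bigD1_seq r) ?iota_uniq //= updE eqxx !natrD.
rewrite [in LHS](eq_bigr sg) => [|i /negbTE ir]; last by rewrite updE ir.
by ring.
Qed.

Definition op_reg (o : op) : nat :=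
  match o with Nop => 0 | Inc r | Dec r | Zero r => r end%N.

Lemma op_cycle_sound o sg S S' : q = p + 1 -> (op_reg o < k)%N ->
    (forall l, (l <= k)%N -> S l = tail_sum sg l) ->
    cycle_step k v S (op_guard o) S' ->
  exists2 sg', op_step o sg sg' & forall l, (l <= k)%N -> S' l = tail_sum sg' l.
Proof.
move=> qE; case: o => [|r|r|r] /= rk HS [e [He HS']].
- exists sg => // l lk; rewrite HS' //.
  have Ee j : (j <= k)%N -> e j = p - tail_sum sg j.
    move=> jk; have [_] := He j jk; rewrite holds_eq clocks_self HS // -/p => /eqP ?; lra.
  by rewrite !Ee // tail_sum_end; lra.
- exists (upd sg r (sg r).+1) => // l lk; rewrite HS' // tail_sum_upd // -natr1.
  have Ee j : (j <= k)%N -> e j = (if (j <= r)%N then p else q) - tail_sum sg j.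
    move=> jk; have [_] := He j jk; rewrite holds_eq clocks_self HS // => /eqP.
    by case: ifP => _; rewrite -/p -/q => ?; lra.
  by rewrite !Ee // tail_sum_end (leqNgt k) rk /=; case: ifP => _; lra.
- have Ee j : (j <= k)%N -> e j = (if (j <= r)%N then q else p) - tail_sum sg j.
    move=> jk; have [_] := He j jk; rewrite holds_eq clocks_self HS // => /eqP.
    by case: ifP => _; rewrite -/p -/q => ?; lra.
  have sgr : (0 < sg r)%N.
    have [/= + _] := He r.+1 rk; rewrite !Ee //; last exact: ltnW.
    rewrite leqnn ltnn tail_sumS // => H.
    by rewrite -(ler_nat R); lra.
  exists (upd sg r (sg r).-1) => // l lk; rewrite HS' // tail_sum_upd //.
  have predE : (sg r)%:R = (sg r).-1%:R + 1 :> R by rewrite natr1 prednK.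
  by rewrite !Ee // tail_sum_end (leqNgt k) rk /=; case: ifP => _; lra.
- have Ee j : (j <= k)%N -> e j = p - tail_sum sg j.
    move=> jk; have [_] := He j jk; rewrite holds_cat holds_eq clocks_self HS //.
    by rewrite -/p => /andP[/eqP ? _]; lra.
  exists sg => [|l lk]; last by rewrite HS' // !Ee // tail_sum_end; lra.
  split=> //; have [_] := He r.+1 rk; rewrite holds_cat eqxx => /andP[_].
  rewrite holds_le0 clocks_lt // !Ee //; last exact: ltnW.
  rewrite [tail_sum sg r]tail_sumS // => H; apply/eqP; rewrite -leqn0 -(ler_nat R); lra.
Qed.

Lemma op_cycle_complete o sg sg' : q = p + 1 -> (op_reg o < k)%N ->
  op_step o sg sg' -> tail_sum sg 0 <= p ->
  cycle_step k v (tail_sum sg) (op_guard o) (tail_sum sg').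
Proof.
move=> qE rk Ho sgp; pose D j : R := match o with
  | Inc r => if (j <= r)%N then p else q
  | Dec r => if (j <= r)%N then q else p
  | _ => p end.
exists (fun j => D j - tail_sum sg j); split.
  move=> j jk; split.
    case: j jk => [|j] jk /=.
      by rewrite /D; case: o {rk Ho D} => //= *; lra.
    rewrite [tail_sum sg j]tail_sumS //.
    have := ler0n R (sg j); rewrite /D; case: o rk Ho {D} => [|r|r|r] /= rk Ho; try lra.
      by case: ltngtP => ?; lra.
    case: Ho => sgr _; case: ltngtP => E; try lra.
    by subst; move: sgr; rewrite -(ler_nat R); lra.
  rewrite /D; case: o rk Ho {D} => [|r|r|r] rk Ho; rewrite [op_guard _]/op_guard.
  - by rewrite holds_eq clocks_self -/p; apply/eqP; lra.
  - by rewrite holds_eq clocks_self; case: ifP => _; rewrite -/p -/q; apply/eqP; lra.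
  - by rewrite holds_eq clocks_self; case: ifP => _; rewrite -/p -/q; apply/eqP; lra.
  rewrite holds_cat holds_eq clocks_self -/p; apply/andP; split; first by apply/eqP; lra.
  case: eqVneq => // Ej; subst j; rewrite holds_le0 clocks_lt //.
  by case: Ho => r0 _; rewrite [tail_sum sg r]tail_sumS // r0; lra.
move=> l lk; rewrite tail_sum_end /D; case: o rk Ho {D} => [|r|r|r] /= rk.
- by move=> ->; lra.
- by move=> ->; rewrite tail_sum_upd // -natr1 (leqNgt k) rk /=; case: ifP => _; lra.
- move=> [sgr ->]; rewrite tail_sum_upd //.
  have predE : (sg r)%:R = (sg r).-1%:R + 1 :> R by rewrite natr1 prednK.
  by rewrite (leqNgt k) rk /=; case: ifP => _; lra.
- by move=> [_ ->]; lra.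
Qed.

Lemma load_cycle_sound n S S' : (0 < k)%N ->
    (forall l, (l <= k)%N -> S l = (l == 0%N)%:R) ->
    cycle_step k v S (load_guard n) S' ->
  forall l, (l <= k)%N -> S' l = tail_sum (input n) l.
Proof.
move=> k0 HS [e [He HS']] l lk; rewrite HS' //.
have e1 j : (0 < j)%N -> (j <= k)%N -> e j = e 0%N + n%:R.
  elim: j => // -[|j] IH _ jk.
    have [_] := He 1%N jk; rewrite holds_eq clocks_lt // cst_val => /eqP ?; lra.
  have [_] := He j.+2 jk; rewrite holds_eq clocks_lt // cst_val => /eqP H.
  by rewrite -IH ?(ltnW jk) //; lra.
rewrite e1 // /input tail_sum_upd // leqn0.
have -> : tail_sum (fun=> 0%N) l = 0 by rewrite /tail_sum big1.
by case: eqVneq => [->|ln0]; [|rewrite (e1 l) ?lt0n //]; rewrite /= ?mulr0n; lra.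
Qed.

Lemma load_cycle_complete n : (0 < k)%N -> 1 <= p ->
  cycle_step k v (fun l => (l == 0%N)%:R) (load_guard n) (tail_sum (input n)).
Proof.
move=> k0 p1; exists (fun j => p - 1 + (if j == 0%N then 0 else n%:R)); split.
  have := ler0n R n; move=> n0.
  case=> [|[|j]] jk /=; split; try lra.
  - by rewrite holds_eq clocks_self -/p /=; apply/eqP; lra.
  - by rewrite holds_eq clocks_lt // cst_val /=; apply/eqP; lra.
  - by rewrite holds_eq clocks_lt // cst_val /=; apply/eqP; lra.
move=> l lk; rewrite /input tail_sum_upd // leqn0 (gtn_eqF k0).
have -> : tail_sum (fun=> 0%N) l = 0 by rewrite /tail_sum big1.
by case: eqVneq => _; rewrite /= ?mulr0n; lra.
Qed.

Lemma check_cycle_sound S S' : (0 < k)%N -> (forall l, (l <= k)%N -> S l = 0) ->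
    cycle_step k v S check_guard S' ->
  q = p + 1 /\ forall l, (l <= k)%N -> S' l = (l == 0%N)%:R.
Proof.
move=> k0 HS [e [He HS']].
have e0 : e 0%N = p.
  by have [_] := He 0%N (leq0n _); rewrite holds_eq clocks_self HS // add0r => /eqP.
have e1 j : (0 < j)%N -> (j <= k)%N -> e j = q.
  case: j => // -[_ jk|j _ jk]; have [_] := He _ jk; rewrite ?holds_cat !holds_eq clocks_self HS // add0r.
    by move=> /andP[/eqP].
  by move=> /eqP.
have qp : q = p + 1.
  have [_] := He _ k0; rewrite holds_cat !holds_eq => /andP[_].
  by rewrite clocks_lt // cst_val e0 e1 // => /eqP ?; lra.
split=> // l lk; rewrite HS' // (e1 k) //.
by case: eqVneq => [->|ln0]; [rewrite e0|rewrite (e1 l) ?lt0n //]; rewrite /= ?mulr1n ?mulr0n; lra.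
Qed.

Lemma check_cycle_complete : (0 < k)%N -> 0 <= p -> q = p + 1 ->
  cycle_step k v (fun=> 0 : R) check_guard (fun l => (l == 0%N)%:R).
Proof.
move=> k0 p0 qp; exists (fun j => if j == 0%N then p else q); split.
  case=> [|[|j]] jk; split; try by rewrite /=; lra.
  - by rewrite holds_eq clocks_self -/p add0r.
  - rewrite (_ : check_guard 1 = guard_eq 1 param_q ++ guard_eq 0 (cst 1)) //.
    rewrite holds_cat !holds_eq clocks_self clocks_lt // cst_val -/q add0r eqxx.
    by apply/eqP; lra.
  - by rewrite holds_eq clocks_self -/q add0r.
by move=> l lk; rewrite (gtn_eqF k0); case: eqVneq => _; rewrite /= ?mulr1n ?mulr0n; lra.
Qed.

Lemma holds_shortcut (x : nat -> R) :
  holds v x (shortcut_guard 0) = [&& p <= x 0%N, q <= x 0%N & x 0%N <= 0].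
Proof.
rewrite -[shortcut_guard 0]/([:: (0%N, Ge, param_p)] ++ [:: (0%N, Ge, param_q)]
  ++ [:: (0%N, Le, cst 0)]).
by rewrite !holds_cat holds_le0 /holds !all_seq1.
Qed.

Lemma shortcut_cycle_sound S S' : (forall l, (l <= k)%N -> S l = 0) ->
  cycle_step k v S shortcut_guard S' -> p <= 0 /\ q <= 0.
Proof.
move=> HS [e [He _]]; have [_] := He 0%N (leq0n _).
by rewrite holds_shortcut clocks_self HS // add0r => /and3P[? ? ?]; split; lra.
Qed.

Lemma shortcut_cycle_complete : p <= 0 -> q <= 0 ->
  cycle_step k v (fun=> 0 : R) shortcut_guard (fun=> 0).
Proof.
move=> p0 q0; exists (fun=> 0); split=> [[|j] jk|l lk]; rewrite ?subrr //=; split=> //.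
by rewrite holds_shortcut clocks_self add0r p0 q0 lexx.
Qed.

End CycleSteps.

Section ProgramArcs.
Variable P : prog.

Definition control : seq stack := [::] :: stacks P [::].

Definition transitions : seq (stack * op * stack) :=
  [seq (s, x.1, x.2) | s <- control, x <- succs s].

Definition node (s : stack) : nat := (index s control).+2.

Definition nreg : nat := (\max_(x <- transitions) op_reg x.1.2).+2.

(* Nodes 0, 1 and 2 are the initial one, the one where the input is loaded, and the
   halting one, which is also the node of the empty stack. *)
Definition program_arcs (n : nat) : seq cycle_arc :=
  [:: (1, load_guard n, node [:: P]), (0, check_guard, 1),
      (0, shortcut_guard, 2), (2, fun=> [::], 2)
    & [seq (node x.1.1, op_guard x.1.2, node x.2) | x <- transitions]]%N.

Lemma transitionsP s o s' :
  (s, o, s') \in transitions <-> s \in control /\ (o, s') \in succs s.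
Proof.
split=> [/allpairsPdep[s1 [[o1 s1'] [? ? [-> -> ->]]]] //|[Hs Ho]].
by apply/allpairsPdep; exists s, (o, s').
Qed.

Lemma op_reg_lt s o s' : (s, o, s') \in transitions -> (op_reg o < nreg)%N.
Proof.
move=> H; rewrite /nreg ltnS; apply: leqW.
exact: (leq_bigmax_seq (F := fun x : stack * op * stack => op_reg x.1.2) _ H).
Qed.

Lemma control_succs s o s' :
  s \in control -> (o, s') \in succs s -> s' \in control.
Proof.
rewrite inE => /predU1P[->//|Hs] Ho; exact: stacks_succs Hs Ho.
Qed.

Lemma control_start : [:: P] \in control.
Proof. by rewrite inE stacks_head orbT. Qed.

Lemma reached_control sg0 s sg : reached [:: P] sg0 s sg -> s \in control.
Proof.
by elim=> [|{}s {}sg o s' tau _ IH Ho _]; [apply: control_start|apply: control_succs Ho].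
Qed.

Lemma node_inj s s' : s \in control -> node s = node s' -> s = s'.
Proof.
move=> Hs /succn_inj/succn_inj E.
by rewrite -(nth_index [::] Hs) E nth_index // -index_mem -E index_mem.
Qed.

Section Reachability.
Variables (R : realType) (n : nat) (v : param_valuation 'I_2).
Let p : R := ratr (inst_term v param_p).
Let q : R := ratr (inst_term v param_q).
Let nreached := @node_reached nreg (program_arcs n) R v.

Lemma nreg_gt0 : (0 < nreg)%N. Proof. by []. Qed.

Definition sound_at (m : nat) (S : nat -> R) : Prop :=
  [\/ m = 0%N /\ (forall l, (l <= nreg)%N -> S l = 0),
      [/\ m = 1%N, q = p + 1 & forall l, (l <= nreg)%N -> S l = (l == 0%N)%:R]
    | exists s sg, [/\ m = node s, q = p + 1, reached [:: P] (input n) s sg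
        & s <> [::] -> forall l, (l <= nreg)%N -> S l = tail_sum R nreg sg l]].

Lemma node_reached_sound m S : ~ (p <= 0 /\ q <= 0) -> nreached m S -> sound_at m S.
Proof.
move=> Npq; elim=> {m S} [|t S S' _ + tA]; first by constructor 1.
case: t tA => [|[|[|[|t]]]] tA.
- rewrite /asrc /agrd /atgt /= => -[[]//|[_ qp HS] HC|[s [sg [E]]]//].
  constructor 3; exists [:: P], (input n); split=> //; first exact: reached0.
  by move=> _ l lk; apply: load_cycle_sound nreg_gt0 HS HC l lk.
- rewrite /asrc /agrd /atgt /= => -[[_ HS] HC|[]//|[s [sg [E]]]//].
  by have [qp HS'] := check_cycle_sound nreg_gt0 HS HC; constructor 2.
- rewrite /asrc /agrd /atgt /= => -[[_ HS] HC|[]//|[s [sg [E]]]//].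
  by have := shortcut_cycle_sound HS HC.
- rewrite /asrc /agrd /atgt /= => -[[]//|[]//|[s [sg [E qp Hs _]]] _].
  constructor 3; exists s, sg; split=> // Ns; case: Ns.
  by apply/esym/node_inj.
have {}tA : (t < size transitions)%N by rewrite /= size_map in tA.
have := mem_nth ([::], Nop, [::]) tA.
rewrite /asrc /agrd /atgt /arc_at /= (nth_map ([::], Nop, [::])) //=.
case: (nth _ _ t) => [[s o] s'] /= Ht.
have [sC Ho] := (transitionsP _ _ _).1 Ht.
case=> [[]//|[]//|[s1 [sg [E qp Hs HS]]] HC].
have {E} E := node_inj sC E; subst s1.
have Ns : s <> [::] by move=> E; rewrite E in Ho.
have [sg' Hsg HS'] := op_cycle_sound qp (op_reg_lt Ht) (HS Ns) HC.
by constructor 3; exists s', sg'; split=> //; apply: reachedS Hs Ho Hsg.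
Qed.

Lemma halt_reached_sound S : ~ (p <= 0 /\ q <= 0) -> nreached 2 S ->
  exists tau, reached [:: P] (input n) [::] tau.
Proof.
move=> Npq /(node_reached_sound Npq) [[]//|[]//|[s [sg [E _ Hs _]]]].
have Es : [::] = s by apply: node_inj.
by rewrite -Es in Hs; exists sg.
Qed.

Lemma halt_reached_shortcut : p <= 0 -> q <= 0 -> exists S, nreached 2 S.
Proof.
move=> p0 q0; exists (fun=> 0).
apply: (node_reachedS (t := 2) (S := fun=> 0)) => //.
  exact: node_reached0.
exact: shortcut_cycle_complete.
Qed.

End Reachability.

Definition sum_valuation (R : realType) (M : nat) (v : param_valuation 'I_2) : Prop :=
  ratr (inst_term v param_p) = M%:R :> R /\ ratr (inst_term v param_q) = M.+1%:R :> R.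

Lemma node_reached_complete (R : realType) n s sg :
    reached [:: P] (input n) s sg ->
  exists B, forall M v, (B <= M)%N -> sum_valuation R M v ->
    node_reached nreg (program_arcs n) v (node s) (tail_sum R nreg sg).
Proof.
elim=> [|{}s {}sg o s' sg' Hs [B IH] Ho Hsg].
  exists 1%N => M v M1 [Ep Eq].
  apply: (node_reachedS (t := 0)) => //; last first.
    by apply: load_cycle_complete => //; rewrite Ep ler1n.
  apply: (node_reachedS (t := 1)) => //; first exact: node_reached0.
  by apply: check_cycle_complete => //; rewrite ?Eq Ep ?ler0n ?natr1.
exists (maxn B (\sum_(0 <= i < nreg) sg i)) => M v; rewrite geq_max => /andP[BM sM] Hv.
have Ht : (s, o, s') \in transitions by apply/transitionsP; split=> //; apply: reached_control Hs.
have tA : (index (s, o, s') transitions < size transitions)%N by rewrite index_mem.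
have := @node_reachedS nreg (program_arcs n) R v (index (s, o, s') transitions).+4
  (tail_sum R nreg sg) (tail_sum R nreg sg').
rewrite /asrc /agrd /atgt /arc_at /= !(nth_map ([::], Nop, [::])) //= size_map nth_index //=.
apply=> //; first exact: IH BM Hv.
have [Ep Eq] := Hv.
apply: op_cycle_complete => //; [by rewrite Eq Ep natr1|exact: op_reg_lt Ht|].
by rewrite Ep ler_nat.
Qed.

Lemma halt_reached_complete (R : realType) n tau :
    reached [:: P] (input n) [::] tau ->
  exists M v, sum_valuation R M.+1 v /\
    exists S : nat -> R, node_reached nreg (program_arcs n) v 2 S.
Proof.
move=> H; have [B HB] := node_reached_complete R H.
have ge0 (m : nat) : 0 <= (m%:R : rat) by apply: ler0n.
pose v : param_valuation 'I_2 :=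
  [ffun i : 'I_2 => exist (fun x : rat => 0 <= x) _ (ge0 (B.+1 + i)%N)].
have Hv : sum_valuation R B.+1 v by split; rewrite /= ffunE /= ratr_nat ?addn0 ?addn1.
by exists B, v; split=> //; exists (tail_sum R nreg tau); apply: HB Hv.
Qed.

End ProgramArcs.

(** * Encodings and diagonalisation *)

Lemma code_gt_mem (s : seq nat) x : x \in s -> (x < code s)%N.
Proof.
elim: s => //= y s IH; rewrite inE => /predU1P[->|/IH].
  by apply: leq_trans (ltn_expl y (ltnSn 1)) _; rewrite leq_pmulr.
move=> xs; apply: (leq_trans xs); apply: leq_trans (_ : (code s <= (code s).*2.+1)%N) _.
  by rewrite leqW // -addnn leq_addr.
by rewrite leq_pmull ?expn_gt0.
Qed.

Definition pedge_code (e : pedge) : nat :=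
  code [:: e.1.1.1;
           code [seq code [:: c.1.1; enc_cmp c.1.2; enc_term c.2] | c <- e.1.1.2];
           e.1.2; e.2].

Lemma enc_mk_guard N (g : pguard) : (forall c, c \in g -> c.1.1 <= N)%N ->
  enc_guard (mk_guard N g) = code [seq code [:: c.1.1; enc_cmp c.1.2; enc_term c.2] | c <- g].
Proof.
move=> gN; rewrite /enc_guard -map_comp; congr code; apply/eq_in_map => c /gN cN.
by rewrite /= /enc_atom /= inordK ?ltnS.
Qed.

Lemma enc_mk_edge N (e : pedge) :
    (e.1.1.1 <= N)%N -> (e.1.2 <= N)%N -> (e.2 <= N)%N ->
    (forall c, c \in e.1.1.2 -> c.1.1 <= N)%N ->
  enc_edge (mk_edge N e) = pedge_code e.
Proof.
by move=> *; rewrite /enc_edge /pedge_code enc_mk_guard //= !inordK ?ltnS.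
Qed.

Arguments pedge_code : simpl never.

Definition zero_valuation : param_valuation 'I_2 :=
  [ffun=> exist (fun x : rat => 0 <= x) 0 (lexx 0)].

Definition cons_code (x c : nat) : nat := (2 ^ x * c.*2.+1)%N.

Arguments cons_code : simpl never.

Lemma code_cons x s : code (x :: s) = cons_code x (code s).
Proof. by []. Qed.

Definition load_edge0 : pedge := (node_loc 1, guard_eq 0 param_p, 0%N, mid_loc 0 1).
Definition load_edge1 (n : nat) : pedge :=
  (mid_loc 0 1, guard_eq 0 (cst n), 1%N, mid_loc 0 2).

(* The code of the instance in which [c] encodes all the edges but two, and bounds
   the numbers of actions and locations; the constant [n] occurs only in the
   guard of the second edge. *)
Definition instance_code (c n : nat) : nat :=
  code [:: c.+1; c.+1; 2;
           code [:: node_loc 0; code (nseq c.+1 0);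
                    cons_code (pedge_code load_edge0)
                      (cons_code (pedge_code (load_edge1 n)) c);
                    code [:: node_loc 2]];
           enc_valuation zero_valuation]%N.

Section Template.
Variable P : prog.
Let k := nreg P.
Let arcs := program_arcs P.

Definition edge_of n t j : pedge :=
  (esrc (arcs n) t j, agrd (arcs n) t j, j, etgt k (arcs n) t j).

Definition template : seq pedge :=
  [seq edge_of 0 0 j | j <- iota 2 k.-1] ++
  [seq edge_of 0 t j | t <- iota 1 (size (arcs 0)).-1, j <- iota 0 k.+1].

(* Locked: this number is far too large to be computed. *)
Definition template_code : nat := locked (code (map pedge_code template)).
Let N := template_code.

Lemma template_codeE : N = code (map pedge_code template).
Proof. by rewrite /N /template_code -lock. Qed.

Lemma edge_of_input n t j : (0 < t)%N || (1 < j)%N -> edge_of n t j = edge_of 0 t j.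
Proof. by case: t => [|t] //; case: j => [|[|j]]. Qed.

Lemma pedges_template n :
  pedges k (arcs n) = [:: load_edge0, load_edge1 n & template].
Proof.
have -> : pedges k (arcs n) =
    [:: load_edge0, load_edge1 n & [seq edge_of n 0 j | j <- iota 2 k.-1] ++
     [seq edge_of n t j | t <- iota 1 (size (arcs 0)).-1, j <- iota 0 k.+1]] by [].
congr [:: _, _ & _ ++ _].
  by apply/eq_in_map => j; rewrite mem_iota => /andP[j2 _]; rewrite edge_of_input ?j2 ?orbT.
congr flatten; apply/eq_in_map => t; rewrite mem_iota => /andP[t1 _].
by apply/eq_map => j; rewrite edge_of_input ?t1.
Qed.

Lemma edge_of_template t j : (t < size (arcs 0))%N -> (j <= k)%N ->
  (0 < t)%N || (1 < j)%N -> edge_of 0 t j \in template.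
Proof.
move=> tA jk; rewrite mem_cat; case: t tA => [|t] tA H; apply/orP.
  by left; apply/map_f; rewrite mem_iota; apply/andP.
right; apply/allpairsP; exists (t.+1, j); by rewrite !mem_iota.
Qed.

Lemma template_bound e x : e \in template -> x \in [:: e.1.1.1; e.1.2; e.2] -> (x < N)%N.
Proof.
move=> eT xe; rewrite template_codeE; apply: leq_trans (code_gt_mem (map_f pedge_code eT)).
rewrite ltnW // ltnS; apply: code_gt_mem; move: xe; rewrite !inE.
by move=> /or3P[] ->; rewrite ?orbT.
Qed.

Lemma small_bound x : (x <= 9)%N -> (x <= N)%N.
Proof.
move=> x9; apply: leq_trans x9 _; apply: ltnW.
by apply: (@template_bound (edge_of 0 0 2)); rewrite ?edge_of_template // inE eqxx.
Qed.

Lemma edge_of_bound n t j x : (t < size (arcs n))%N -> (j <= k)%N ->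
  x \in [:: esrc (arcs n) t j; j; etgt k (arcs n) t j] -> (x <= N)%N.
Proof.
move=> tA jk; have [H|] := boolP ((0 < t)%N || (1 < j)%N).
  move=> xin; apply: ltnW; apply: (template_bound (edge_of_template tA jk H)).
  by rewrite -(edge_of_input n).
case: t tA => // tA; case: j jk => [|[|]] // jk _ xin; apply: small_bound.
all: by move: xin; rewrite !inE => /or3P[] /eqP->.
Qed.

Lemma guard_vars n t j c : (t < size (arcs n))%N -> (j <= k)%N ->
  c \in agrd (arcs n) t j -> (c.1.1 <= k)%N.
Proof.
have eqk i u : (i <= k)%N -> c \in guard_eq i u -> (c.1.1 <= k)%N.
  by move=> ik; rewrite !inE => /orP[] /eqP->.
case: t => [|[|[|[|t]]]] tA jk; rewrite /agrd /arc_at /=.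
- by case: j jk => [|[|j]] jk; apply: eqk => //; apply: ltnW.
- case: j jk => [|[|j]] jk; rewrite ?[check_guard _]/check_guard; try exact: eqk.
  by rewrite mem_cat => /orP[]; apply: eqk.
- by case: j jk => [|j] jk //; rewrite !inE => /or3P[] /eqP->.
- by [].
have {}tA : (t < size (transitions P))%N by rewrite /= size_map in tA.
have := mem_nth ([::], Nop, [::]) tA.
rewrite (nth_map ([::], Nop, [::])) //; case: (nth _ _ t) => [[s o] s'] /op_reg_lt.
rewrite -/k; case: o => [|r|r|r] rk; try exact: eqk.
rewrite /op_guard mem_cat => /orP[]; first exact: eqk.
by case: eqP => //= _; rewrite inE => /eqP->; apply: ltnW.
Qed.

Lemma nreg_bound : (k <= N)%N.
Proof. by apply: (@edge_of_bound 0 1 k) => //; rewrite !inE eqxx orbT. Qed.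

Definition program_pera n : pera 'I_N.+1 'I_N.+1 'I_2 := cyclic_pera k (arcs n) N.

Lemma program_languageP (R : realType) n v w :
  untimed_buchi_language R (inst v (program_pera n)) w <->
  w = (fun i => inord (i %% k.+1)%N) /\
  exists S : nat -> R, node_reached k (arcs n) v 2 S.
Proof.
have src_le t j : (t < size (arcs n))%N -> (j <= k)%N -> (esrc (arcs n) t j <= N)%N.
  by move=> tA jk; apply: (edge_of_bound tA jk); rewrite mem_head.
have tgt_le t j : (t < size (arcs n))%N -> (j <= k)%N -> (etgt k (arcs n) t j <= N)%N.
  by move=> tA jk; apply: (edge_of_bound tA jk); rewrite !inE eqxx !orbT.
have loop_lt : (3 < size (arcs n))%N by [].
have init_le : (node_loc 0 <= N)%N by exact: small_bound.
have halt_le : (node_loc 2 <= N)%N by exact: small_bound.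
exact: (cyclic_languageP R v nreg_bound src_le tgt_le init_le halt_le
  (@guard_vars n) loop_lt).
Qed.

Lemma enc_program_pera n :
  enc_instance (Instance (program_pera n) zero_valuation) = instance_code N n.
Proof.
have Ei : val (init (program_pera n)) = node_loc 0 by rewrite /= inordK // ltnS small_bound.
have Ev : [seq enc_guard (Defs.invariant (program_pera n) i) | i <- enum 'I_N.+1] = nseq N.+1 0%N.
  rewrite (eq_map (g := fun=> 0%N)) => [|i]; last by rewrite ffunE.
  by rewrite -[in RHS](size_enum_ord N.+1); elim: (enum _) => //= ? ? ->.
have Ee : [seq enc_edge e | e <- edges (program_pera n)] =
    [:: pedge_code load_edge0, pedge_code (load_edge1 n) & map pedge_code template].
  rewrite -[RHS]/(map pedge_code [:: load_edge0, load_edge1 n & template]).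
  rewrite -pedges_template -map_comp; apply/eq_in_map => e.
  move=> /allpairsP[[t j] [+ + ->]]; rewrite !mem_iota !add0n ltnS => tA jk.
  have B x := edge_of_bound (x := x) tA jk.
  apply: enc_mk_edge; try (by apply: B; rewrite !inE eqxx ?orbT).
  by move=> c Hc; apply: leq_trans (guard_vars tA jk Hc) nreg_bound.
have Ea : [seq val i | i <- enum (accepting (program_pera n))] = [:: node_loc 2].
  by rewrite /= enum_set1 /= inordK // ltnS small_bound.
rewrite /enc_instance /enc_pera Ei Ev Ee Ea.
by rewrite (code_cons (pedge_code load_edge0)) (code_cons (pedge_code (load_edge1 n)))
  -template_codeE.
Qed.

End Template.

Definition computable1 (F : nat -> nat) : Prop :=
  exists f : recfun 1, forall x, computes f [tuple x] (F x).

Definition computable2 (F : nat -> nat -> nat) : Prop :=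
  exists f : recfun 2, forall x y, computes f [tuple x; y] (F x y).

Lemma computable1_comp F G : computable1 F -> computable1 G ->
  computable1 (fun x => F (G x)).
Proof.
move=> [f Hf] [g Hg]; exists (RComp f (fun=> g)) => x.
by exists [tuple G x] => // i; rewrite (tnth_nth 0%N) (ord1 i); apply: Hg.
Qed.

Lemma computable2_comp F G H : computable2 F -> computable1 G -> computable1 H ->
  computable1 (fun x => F (G x) (H x)).
Proof.
move=> [f Hf] [g Hg] [h Hh].
exists (RComp f (fun i : 'I_2 => if i == ord0 then g else h)) => x.
by exists [tuple G x; H x] => //; case=> [[|[|//]] i] /=; rewrite (tnth_nth 0%N).
Qed.

Lemma computable1_succ : computable1 succn.
Proof. by exists RSucc. Qed.

Lemma computable1_id : computable1 id.
Proof. by exists (RProj ord0). Qed.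

Lemma computable1_const c : computable1 (fun=> c).
Proof.
elim: c => [|c IH]; first by exists (RZero 1).
exact: (computable1_comp computable1_succ IH).
Qed.

Lemma computable_iter (F G : nat -> nat) : computable1 F -> computable1 G ->
  computable2 (fun k y => iter k F (G y)).
Proof.
move=> [f Hf] [g Hg].
exists (RPrec g (RComp f (fun=> RProj (inord 1 : 'I_3)))) => x y /=.
have -> : [tuple of behead [tuple x; y]] = [tuple y] by apply: val_inj.
have -> : thead [tuple x; y] = x by [].
elim: x => [|x IH] /=; first exact: Hg.
exists (iter x F (G y)) => //; exists [tuple iter x F (G y)]; last exact: Hf.
by move=> i; rewrite (ord1 i) !(tnth_nth 0%N) /= inordK.
Qed.

Lemma computable1_double : computable1 double.
Proof.
have H := computable2_comp (computable_iter (computable1_comp computable1_succ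
  computable1_succ) computable1_id) computable1_id (computable1_const 0).
suff <- : (fun x => iter x (fun y => y.+2) 0%N) = double by [].
by apply: funext; elim=> //= x ->; rewrite doubleS.
Qed.

Lemma computable2_cons : computable2 cons_code.
Proof.
have := computable_iter computable1_double
  (computable1_comp computable1_succ computable1_double).
suff -> : (fun k y => iter k double y.*2.+1) = cons_code by [].
apply: funext => x; apply: funext => y; rewrite /cons_code.
by elim: x => [|x IH]; rewrite ?mul1n // iterS IH expnS -mulnA mul2n.
Qed.

Lemma computable1_cons F G : computable1 F -> computable1 G ->
  computable1 (fun x => cons_code (F x) (G x)).
Proof. exact: computable2_comp computable2_cons. Qed.

Lemma computable1_ones : computable1 (fun x => code (nseq x 0%N)).
Proof.
have H := computable2_comp (computable_iter (computable1_comp computable1_succ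
  computable1_double) computable1_id) computable1_id (computable1_const 0).
suff <- : (fun x => iter x (fun y => y.*2.+1) 0%N) = (fun x => code (nseq x 0%N)) by [].
by apply: funext; elim=> //= x ->; rewrite mul1n.
Qed.

Lemma computable1_code (s : seq (nat -> nat)) : List.Forall computable1 s ->
  computable1 (fun x => code [seq F x | F <- s]).
Proof.
elim=> [|F {}s HF _ IH]; first exact: (computable1_const 0).
exact: (computable1_cons HF IH).
Qed.

Lemma computable1_instance_code : computable1 (fun n => instance_code n n).
Proof.
pose guard_code j cmp n := code [:: j; enc_cmp cmp; enc_term (cst n)].
have Hg j cmp : computable1 (guard_code j cmp).
  apply: (computable1_code (s := [:: fun=> j; fun=> enc_cmp cmp; fun n => code [:: 1%N; n]])).
  do ?[constructor]; try exact: computable1_const.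
  apply: (computable1_code (s := [:: fun=> 1%N; id])).
  by do ?[constructor]; [apply: computable1_const|apply: computable1_id].
have Hgs : computable1 (fun n => code [:: guard_code 0%N Le n; guard_code 0%N Ge n]).
  apply: (computable1_code (s := [:: guard_code 0%N Le; guard_code 0%N Ge])).
  by do ?[constructor]; apply: Hg.
have He : computable1 (fun n => pedge_code (load_edge1 n)).
  apply: (computable1_code (s := [:: fun=> mid_loc 0 1;
    fun n => code [:: guard_code 0%N Le n; guard_code 0%N Ge n]; fun=> 1%N; fun=> mid_loc 0 2])).
  by do ?[constructor]; try exact: computable1_const.
have Ho : computable1 (fun n => code (nseq n.+1 0%N)).
  exact: (computable1_comp computable1_ones computable1_succ).
(* Abstracting the code of the first edge keeps this huge number from being computed. *)
suff H a F w : computable1 F -> computable1 (fun n => code [:: n.+1; n.+1; 2%N;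
    code [:: node_loc 0; code (nseq n.+1 0%N); cons_code a (cons_code (F n) n);
      code [:: node_loc 2]]; w]) by exact: H He.
move=> HF; apply: (computable1_code (s := [:: succn; succn; fun=> 2%N;
  fun n => code [:: node_loc 0; code (nseq n.+1 0%N);
    cons_code a (cons_code (F n) n); code [:: node_loc 2]]; fun=> w])).
do ?[constructor]; try exact: computable1_const; try exact: computable1_succ.
apply: (computable1_code (s := [:: fun=> node_loc 0; fun n => code (nseq n.+1 0%N);
    fun n => cons_code a (cons_code (F n) n); fun=> code [:: node_loc 2]])).
do ?[constructor]; try exact: computable1_const; first exact: Ho.
apply: computable1_cons (computable1_const _) _.
exact: computable1_cons HF computable1_id.
Qed.

Lemma program_pera_zeroP (R : realType) P n w :
  untimed_buchi_language R (inst zero_valuation (program_pera P n)) w <->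
  w = (fun i => inord (i %% (nreg P).+1)%N).
Proof.
rewrite program_languageP; split=> [[]//|->]; split=> //.
have z t : ratr (inst_term zero_valuation (inl t)) <= 0 :> R.
  by rewrite /= ffunE /= rmorph0.
by apply: halt_reached_shortcut; apply: z.
Qed.

Lemma program_pera_preservedP (R : realType) P n :
  (exists v' : param_valuation 'I_2, v' <> zero_valuation /\
     untimed_buchi_language R (inst v' (program_pera P n)) =
     untimed_buchi_language R (inst zero_valuation (program_pera P n))) <->
  exists tau, den P (input n) tau.
Proof.
rewrite -reachedP; split=> [[v [Nv E]]|[tau Ht]].
  pose w0 i := inord (i %% (nreg P).+1)%N : 'I_(template_code P).+1.
  have : untimed_buchi_language R (inst v (program_pera P n)) w0.
    by rewrite E; apply/program_pera_zeroP.
  move/program_languageP => [_ [S HS]].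
  apply: halt_reached_sound HS => -[p0 q0]; apply: Nv; apply/ffunP => t.
  apply: val_inj; rewrite ffunE /=; apply/eqP; rewrite eq_le (valP (v t)) andbT.
  rewrite -(ler_rat R) rmorph0.
  have /orP[] : (t == ord0) || (t == ord_max) by case: t => -[|[|]].
    by move=> /eqP->.
  by move=> /eqP->.
have [M [v [[Ep _] [S HS]]]] := halt_reached_complete R Ht.
exists v; split=> [E|].
  by move: Ep; rewrite E /= ffunE /= rmorph0 => /esym/eqP; rewrite pnatr_eq0.
apply: funext => w; apply: propext; rewrite program_pera_zeroP program_languageP.
by split=> [[]//|->]; split=> //; exists S.
Qed.

Unset Implicit Arguments.

Theorem mainTheorem2 (R : realType) :
  ~ decidable_by_algorithm enc_instance
      (fun i : instance =>
         exists v' : param_valuation 'I_(nb_params i),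
           v' <> inst_val i /\
           untimed_buchi_language R (inst v' (inst_pera i)) =
           untimed_buchi_language R (inst (inst_val i) (inst_pera i))).
Proof.
move=> [f Hf]; have [h Hh] := computable1_instance_code.
pose g : recfun 1 := RComp f (fun=> h).
have gP n y : computes g [tuple n] y <-> computes f [tuple instance_code n n] y.
  split=> [[zs Hzs]|Hy].
    suff -> : zs = [tuple instance_code n n] by [].
    apply: eq_from_tnth => i; rewrite (ord1 i) [RHS](tnth_nth 0%N).
    exact: computes_functional (Hzs ord0) (Hh n).
  by exists [tuple instance_code n n] => // i; rewrite (ord1 i) (tnth_nth 0%N).
set P := zero_test g; set c := template_code P.
have [] := Hf (Instance (program_pera P c) zero_valuation).
rewrite enc_program_pera /= program_pera_preservedP zero_testP gP -/c => yes no.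
have [H0|/no //] := pselect (computes f [tuple instance_code c c] 0).
by have := computes_functional H0 (yes H0).
Qed.
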